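(* Let $n\ge 1$ and let $R=\bigoplus_{\alpha\in Q_+}R_\alpha$ be a KLR algebra of type $A_n$ over a field $\mathbb F$. (1) There exists a bijection between the irreducible homogeneous representations of $R$ (that is, of the algebras $R_\alpha$, $\alpha\in Q_+$; up to isomorphism and degree shift) and the Dyck paths of semi-length $n+1$, with the following property: if such a representation is given by a homogeneous component $C$ of words of length $k$ (i.e. it is $S(C)$ up to isomorphism and degree shift), then the corresponding Dyck path has (sum of peak heights) $-$ (number of peaks) $=k$. (2) For every $k\ge 0$, the total number of homogeneous representations of $R$ (up to isomorphism and degree shift) which are given by homogeneous words of length $k$ is $T(n+1,k)$, where $T(m,k)$ denotes the number of Dyck paths of semi-length $m$ with (sum of peak heights) $-$ (number of peaks) $=k$.
   Context: A Dyck path of semi-length $m$ is a lattice path from $(0,0)$ to $(2m,0)$ with steps $\langle 1,1\rangle$ (rise) and $\langle 1,-1\rangle$ (fall) that never goes below the $x$-axis. A peak is a rise immediately followed by a fall; its height is the $y$-coordinate of the common endpoint of the two steps. KLR algebra. Let $\Gamma$ be a quiver whose underlying graph is the Dynkin diagram $A_n$: vertices $I=\{1,\dots,n\}$, one arrow (with some orientation) between $i$ and $i+1$ for each $i$, and no other arrows. Vertices $i\ne j$ are neighbors if $i\to j$ or $i\leftarrow j$. Let $Q_+=\bigoplus_{i\in I}\mathbb Z_{\ge0}\alpha_i$. For $\alpha=\sum c_i\alpha_i\in Q_+$ its height is $d=\sum c_i$, and $\langle I\rangle_\alpha$ is the set of words $\boldsymbol w=[w_1,\dots,w_d]$ in $I$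 in which each $i$ occurs exactly $c_i$ times. $R_\alpha$ is the associative $\mathbb F$-algebra generated by $e(\boldsymbol w)$ ($\boldsymbol w\in\langle I\rangle_\alpha$), $\psi_1,\dots,\psi_{d-1}$, $y_1,\dots,y_d$ subject to: $e(\boldsymbol w)e(\boldsymbol v)=\delta_{\boldsymbol w\boldsymbol v}e(\boldsymbol w)$; $\sum_{\boldsymbol w}e(\boldsymbol w)=1$; $y_ke(\boldsymbol w)=e(\boldsymbol w)y_k$; $\psi_ke(\boldsymbol w)=e(s_k\boldsymbol w)\psi_k$, where $s_k$ swaps the letters in positions $k,k+1$; $y_ky_\ell=y_\ell y_k$; $y_k\psi_\ell=\psi_\ell y_k$ for $k\ne\ell,\ell+1$; $(y_{k+1}\psi_k-\psi_ky_k)e(\boldsymbol w)=(\psi_ky_{k+1}-y_k\psi_k)e(\boldsymbol w)=e(\boldsymbol w)$ if $w_k=w_{k+1}$, and both are $0$ otherwise; $\psi_k^2e(\boldsymbol w)$ equals $0$ if $w_k=w_{k+1}$, $(y_k-y_{k+1})e(\boldsymbol w)$ if $w_k\to w_{k+1}$, $(y_{k+1}-y_k)e(\boldsymbol w)$ if $w_k\leftarrow w_{k+1}$, and $e(\boldsymbol w)$ otherwise; $\psi_k\psi_\ell=\psi_\ell\psi_k$ for $|k-\ell|>1$; $(\psi_{k+1}\psi_k\psi_{k+1}-\psi_k\psi_{k+1}\psi_k)e(\boldsymbol w)$ equals $e(\boldsymbol w)$ if $w_{k+2}=w_k\to w_{k+1}$, $-e(\boldsymbol w)$ if $w_{k+2}=w_k\leftarrow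 w_{k+1}$, and $0$ otherwise. It is $\mathbb Z$-graded by $\deg e(\boldsymbol w)=0$, $\deg y_i=2$, and $\deg\psi_ie(\boldsymbol w)=-2,\,1,\,0$ according to whether $w_i=w_{i+1}$, $w_i,w_{i+1}$ are neighbors, or $w_i\neq w_{i+1}$ are not neighbors. A homogeneous representation is an irreducible (finite-dimensional) graded representation of some $R_\alpha$ concentrated in a single degree. Weight graph. $G_\alpha$ is the graph with vertex set $\langle I\rangle_\alpha$ in which $\boldsymbol w,\boldsymbol v$ are joined by an edge if $\boldsymbol v=s_r\boldsymbol w$ for some $r$ such that $w_r,w_{r+1}$ are neither equal nor neighbors. A word $\boldsymbol w$ is homogeneous if whenever $w_r=w_s$ with $r<s$, there are $t,u$ with $r<t<u<s$ such that $w_r$ is a neighbor of both $w_t$ and $w_u$. A connected component $C$ of $G_\alpha$ is homogeneous if all its words are homogeneous. For a homogeneous component $C$, $S(C)$ is the $R_\alpha$-module with basis $\{v_{\boldsymbol w}:\boldsymbol w\in C\}$ (placed in a single degree) and action $e(\boldsymbol w')v_{\boldsymbol w}=\delta_{\boldsymbol w,\boldsymbol w'}v_{\boldsymbol w}$, $y_rv_{\boldsymbol w}=0$, $\psi_rv_{\boldsymbol w}=v_{s_r\boldsymbol w}$ if $s_r\boldsymbol w\in C$ and $0$ otherwise. By a theorem of Kleshchev and Ram, the $S(C)$, for $C$ ranging over homogeneous components of $G_\alpha$, are pairwise non-isomorphic and are exactly the homogeneous representations of $R_\alpha$ up to isomorphism (and degree shift). *)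

(* Defs.v *)
From HB Require Import structures.
From Stdlib Require Eqdep_dec.
From mathcomp Require Import all_boot perm all_algebra.
From mathcomp Require Import boolp classical_sets functions cardinality.
From mathcomp Require Import finmap monalg zify.

Set Implicit Arguments.
Unset Strict Implicit.
Unset Printing Implicit Defensive.

Import GRing.Theory.

Local Open Scope ring_scope.

Section Dyck.
Implicit Types (p : seq bool) (m k i : nat).

(* [true] is a rise, [false] a fall; [path_height p i] is the y-coordinate
   reached after the first [i] steps. *)
Definition path_height p i : int :=
  \sum_(b <- take i p) (if b then 1 else -1).

Definition is_dyck p : bool :=
  [forall i : 'I_(size p).+1, 0 <= path_height p i]
  && (path_height p (size p) == 0).

Definition dyck_path m := {p : (m.*2).-tuple bool | is_dyck p}.

Definition peaks p : seq nat :=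
  [seq i <- iota 0 (size p).-1 | nth false p i && ~~ nth false p i.+1].

Definition sum_peak_heights p : int :=
  \sum_(i <- peaks p) path_height p i.+1.

Definition peak_stat m (D : dyck_path m) : int :=
  sum_peak_heights (val D) - (size (peaks (val D)))%:Z.

Definition dyck_count m k : nat :=
  #|[set D : dyck_path m | peak_stat D == k%:Z]|.

End Dyck.

(* The quotient of a (noncommutative) ring by the two-sided ideal generated by
   a set of relations [a = b].  The ideal may be improper, so the quotient is
   only a [pzRingType]. *)

Section PresentedRing.
Context (A : nzRingType) (rel : A -> A -> Prop).

Inductive rel_ideal : A -> Prop :=
| RelIdeal_rel a b : rel a b -> rel_ideal (a - b)
| RelIdeal_0 : rel_ideal 0
| RelIdeal_add a b : rel_ideal a -> rel_ideal b -> rel_ideal (a + b)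
| RelIdeal_mull x a : rel_ideal a -> rel_ideal (x * a)
| RelIdeal_mulr x a : rel_ideal a -> rel_ideal (a * x).

Definition rel_ideal_pred : pred A := fun a => `[< rel_ideal a >].

Lemma rel_ideal_predP a : reflect (rel_ideal a) (a \in rel_ideal_pred).
Proof. exact: asboolP. Qed.

Lemma rel_ideal_zmod_closed : zmod_closed rel_ideal_pred.
Proof.
split; first by apply/rel_ideal_predP; exact: RelIdeal_0.
move=> a b /rel_ideal_predP ha /rel_ideal_predP hb; apply/rel_ideal_predP.
by apply: RelIdeal_add => //; rewrite -mulN1r; exact: RelIdeal_mull.
Qed.

HB.instance Definition _ :=
  GRing.isZmodClosed.Build A rel_ideal_pred rel_ideal_zmod_closed.

Definition rel_ideal_zmod : zmodClosed A :=
  GRing.ZmodClosed.clone A rel_ideal_pred _.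

Definition pres_ring : Type := Quotient.quot rel_ideal_zmod.

HB.instance Definition _ := GRing.Zmodule.on pres_ring.

Definition pres_pi (a : A) : pres_ring :=
  (\pi_(Quotient.quot rel_ideal_zmod) a)%qT.
Definition pres_repr (x : pres_ring) : A :=
  repr (x : Quotient.quot rel_ideal_zmod).

Lemma pres_reprK x : pres_pi (pres_repr x) = x.
Proof. exact: reprK. Qed.

Lemma pres_piP a b : rel_ideal (a - b) <-> pres_pi a = pres_pi b.
Proof.
have E := Quotient.idealrBE rel_ideal_zmod a b.
split; first by move=> h; apply/eqP; rewrite /pres_pi -E; apply/rel_ideal_predP.
by move=> /eqP; rewrite /pres_pi -E => /rel_ideal_predP.
Qed.

Lemma pres_piD a b : pres_pi (a + b) = pres_pi a + pres_pi b.
Proof. by rewrite /pres_pi !piE. Qed.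

Lemma pres_piN a : pres_pi (- a) = - pres_pi a.
Proof. by rewrite /pres_pi !piE. Qed.

Lemma pres_pi0 : pres_pi 0 = 0.
Proof. by rewrite /pres_pi !piE. Qed.

Definition pres_one : pres_ring := pres_pi 1.
Definition pres_mul (x y : pres_ring) : pres_ring :=
  pres_pi (pres_repr x * pres_repr y).

Lemma pres_piM a b : pres_mul (pres_pi a) (pres_pi b) = pres_pi (a * b).
Proof.
apply/pres_piP; set a' := pres_repr _; set b' := pres_repr _.
have ha : rel_ideal (a' - a) by apply/pres_piP; rewrite pres_reprK.
have hb : rel_ideal (b' - b) by apply/pres_piP; rewrite pres_reprK.
have -> : a' * b' - a * b = (a' - a) * b' + a * (b' - b).
  by rewrite mulrBl mulrBr addrA subrK.
by apply: RelIdeal_add; [exact: RelIdeal_mulr | exact: RelIdeal_mull].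
Qed.

Lemma pres_mulA : associative pres_mul.
Proof.
move=> x y z; rewrite -[x]pres_reprK -[y]pres_reprK -[z]pres_reprK.
by rewrite !pres_piM mulrA.
Qed.

Lemma pres_mul1 : left_id pres_one pres_mul.
Proof. by move=> x; rewrite -[x]pres_reprK pres_piM mul1r. Qed.

Lemma pres_mulr1 : right_id pres_one pres_mul.
Proof. by move=> x; rewrite -[x]pres_reprK pres_piM mulr1. Qed.

Lemma pres_mulDl : left_distributive pres_mul +%R.
Proof.
move=> x y z; rewrite -[x]pres_reprK -[y]pres_reprK -[z]pres_reprK.
by rewrite -pres_piD !pres_piM mulrDl pres_piD.
Qed.

Lemma pres_mulDr : right_distributive pres_mul +%R.
Proof.
move=> x y z; rewrite -[x]pres_reprK -[y]pres_reprK -[z]pres_reprK.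
by rewrite -pres_piD !pres_piM mulrDr pres_piD.
Qed.

HB.instance Definition _ := GRing.Zmodule_isPzRing.Build pres_ring
  pres_mulA pres_mul1 pres_mulr1 pres_mulDl pres_mulDr.

Lemma pres_pi1 : pres_pi 1 = 1. Proof. by []. Qed.

Lemma pres_piMr a b : pres_pi (a * b) = pres_pi a * pres_pi b.
Proof. by rewrite -pres_piM. Qed.

End PresentedRing.

Section PresentedAlg.
Context (F : fieldType) (A : lalgType F) (rel : A -> A -> Prop).

Definition pres_scale (c : F) (x : pres_ring rel) : pres_ring rel :=
  pres_pi rel (c *: pres_repr x).

Lemma pres_piZ c a : pres_scale c (pres_pi rel a) = pres_pi rel (c *: a).
Proof.
apply/pres_piP; rewrite -scalerBr -[_ - a]mul1r scalerAl.
by apply: RelIdeal_mull; apply/pres_piP; rewrite pres_reprK.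
Qed.

Lemma pres_scaleA c d x : pres_scale c (pres_scale d x) = pres_scale (c * d) x.
Proof. by rewrite -[x]pres_reprK !pres_piZ scalerA. Qed.

Lemma pres_scale1 : left_id 1 pres_scale.
Proof. by move=> x; rewrite -[x]pres_reprK pres_piZ scale1r. Qed.

Lemma pres_scaleDr : right_distributive pres_scale +%R.
Proof.
move=> c x y; rewrite -[x]pres_reprK -[y]pres_reprK -pres_piD !pres_piZ.
by rewrite scalerDr pres_piD.
Qed.

Lemma pres_scaleDl x : {morph pres_scale^~ x : c d / c + d}.
Proof. by move=> c d; rewrite -[x]pres_reprK !pres_piZ scalerDl pres_piD. Qed.

HB.instance Definition _ := GRing.Zmodule_isLmodule.Build F (pres_ring rel)
  pres_scaleA pres_scale1 pres_scaleDr pres_scaleDl.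

Lemma pres_scaleAl (c : F) (x y : pres_ring rel) : c *: (x * y) = (c *: x) * y.
Proof.
rewrite -[x]pres_reprK -[y]pres_reprK -pres_piMr.
rewrite [LHS]pres_piZ [c *: pres_pi _ _]pres_piZ -pres_piMr.
by rewrite scalerAl.
Qed.

Lemma pres_scaleAr :
  (forall (c : F) (a b : A), c *: (a * b) = a * (c *: b)) ->
  forall (c : F) (x y : pres_ring rel), c *: (x * y) = x * (c *: y).
Proof.
move=> scaleAr c x y; rewrite -[x]pres_reprK -[y]pres_reprK -pres_piMr.
rewrite [LHS]pres_piZ [c *: pres_pi _ _]pres_piZ -pres_piMr.
by rewrite scaleAr.
Qed.

End PresentedAlg.

(* Endomorphisms given for each generator extend to an action of the free
   algebra on these generators. *)

Section FreeAction.
Context (F : fieldType) (G : choiceType) (V : vectType F) (op : G -> 'End(V)).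
Local Notation free := {malg F[{fmonom G}]}.

Lemma free_scaleAr (c : F) (a b : free) : c *: (a * b) = a * (c *: b).
Proof.
rewrite [a * b]malgME (malgMEw (fsubset_refl _) (msuppZ_le c b)).
rewrite scaler_sumr; apply: eq_bigr => m1 _; rewrite scaler_sumr.
apply: eq_bigr => m2 _; rewrite mcoeffZ; apply/malgP => m.
by rewrite mcoeffZ !mcoeffU mulrnAr mulrCA.
Qed.

Definition mon_act (m : {fmonom G}) : 'End(V) :=
  foldr (fun g h => (op g \o h)%VF) \1%VF (m : seq G).

Definition free_act (a : free) : 'End(V) :=
  \sum_(m <- msupp a) a@_m *: mon_act m.

Lemma mon_actM m1 m2 : mon_act (mmul m1 m2) = (mon_act m1 \o mon_act m2)%VF.
Proof.
have -> : mmul m1 m2 = FMonom (m1 ++ m2) by exact: fmmulE.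
rewrite /mon_act /=; elim: (m1 : seq _) => [|g s IH] /=.
  by rewrite comp_lfun1l.
by rewrite IH comp_lfunA.
Qed.

Lemma free_actEw (d : {fset {fmonom G}}) (a : free) :
  (msupp a `<=` d)%fset -> free_act a = \sum_(m <- d) a@_m *: mon_act m.
Proof.
move=> le; rewrite /free_act (big_fset_incl _ le) //= => m _ /mcoeff_outdom ->.
by rewrite scale0r.
Qed.

Lemma free_act_linear : linear free_act.
Proof.
move=> c a b; pose D := (msupp a `|` msupp b `|` msupp (c *: a + b))%fset.
have h1 : (msupp a `<=` D)%fset by rewrite /D -fsetUA fsubsetUl.
have h2 : (msupp b `<=` D)%fset by rewrite /D fsetUAC fsubsetUr.
have h3 : (msupp (c *: a + b) `<=` D)%fset by rewrite fsubsetUr.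
rewrite (free_actEw h1) (free_actEw h2) (free_actEw h3).
rewrite scaler_sumr -big_split /=.
by apply: eq_bigr => m _; rewrite mcoeffD mcoeffZ scalerDl scalerA.
Qed.

HB.instance Definition _ := GRing.isLinear.Build F free 'End(V) _
  free_act free_act_linear.

Lemma free_actU c m : free_act << c *g m >> = c *: mon_act m.
Proof. by rewrite (free_actEw msuppU_le) big_seq_fset1 mcoeffUU. Qed.

Lemma free_act1 : free_act 1 = \1%VF.
Proof.
rewrite free_actU scale1r /mon_act.
by have -> : mone = FMonom [::] :> {fmonom G} by exact: fmoneE.
Qed.

Lemma free_actM a b : free_act (a * b) = (free_act a \o free_act b)%VF.
Proof.
have suml (I : eqType) (r : seq I) (f : I -> 'End(V)) g :
    ((\sum_(i <- r) f i) \o g = \sum_(i <- r) (f i \o g))%VF.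
  by elim/big_rec2: _ => [|i x y _ <-]; rewrite ?comp_lfun0l ?comp_lfunDl.
have sumr (I : eqType) (r : seq I) (f : I -> 'End(V)) g :
    (g \o (\sum_(i <- r) f i) = \sum_(i <- r) (g \o f i))%VF.
  by elim/big_rec2: _ => [|i x y _ <-]; rewrite ?comp_lfun0r ?comp_lfunDr.
rewrite [a * b]malgME linear_sum /= [free_act a]/free_act suml.
apply: eq_bigr => m1 _; rewrite linear_sum /= [free_act b]/free_act sumr.
apply: eq_bigr => m2 _.
by rewrite free_actU mon_actM -comp_lfunZl -comp_lfunZr scalerA.
Qed.

Lemma free_act0 : free_act 0 = 0. Proof. exact: linear0. Qed.

Lemma free_actD a b : free_act (a + b) = free_act a + free_act b.
Proof. exact: linearD. Qed.

Lemma free_actZ c a : free_act (c *: a) = c *: free_act a.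
Proof. exact: linearZ. Qed.

Lemma free_actB a b : free_act (a - b) = free_act a - free_act b.
Proof. exact: linearB. Qed.

Lemma free_act_sum (I : finType) (f : I -> free) :
  free_act (\sum_i f i) = \sum_i free_act (f i).
Proof. exact: linear_sum. Qed.

Lemma free_act_gen g : free_act << fmu g >> = op g.
Proof. by rewrite free_actU scale1r fmuE /mon_act /= comp_lfun1r. Qed.

End FreeAction.

(* The vertices 1, ..., n are represented by the elements 0, ..., n-1
   of 'I_n. *)

Record typeA_quiver n := TypeAQuiver {
  arrow : rel 'I_n;
  arrow_adjacent : forall i j,
    (arrow i j || arrow j i) = (i.+1 == j :> nat) || (j.+1 == i :> nat);
  arrow_single : forall i j, ~~ (arrow i j && arrow j i)
}.

Definition neighbor n (Q : typeA_quiver n) : rel 'I_n :=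
  fun i j => arrow Q i j || arrow Q j i.

Definition Qplus n := {ffun 'I_n -> nat}.

Definition ht n (alpha : Qplus n) : nat := (\sum_i alpha i)%N.

Section Words.
Context (n : nat) (alpha : Qplus n).
Local Notation d := (ht alpha).

Definition word :=
  {w : d.-tuple 'I_n | [forall i, count_mem i w == alpha i]}.

Definition letter (w : word) (i : 'I_d) : 'I_n := tnth (val w) i.

(* [k : 'I_d.-1] stands for the pair of consecutive positions
   [pos0 k] = k, [pos1 k] = k+1 (counted from 0). *)
Definition pos0 (k : 'I_d.-1) : 'I_d := widen_ord (leq_pred d) k.

Lemma pos1_subproof (k : 'I_d.-1) : (k.+1 < d)%N.
Proof. by rewrite -ltn_predRL. Qed.

Definition pos1 (k : 'I_d.-1) : 'I_d := Ordinal (pos1_subproof k).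

Lemma swap_subproof (k : 'I_d.-1) (w : word) :
  [forall i, count_mem i [tuple letter w (tperm (pos0 k) (pos1 k) j) | j < d]
             == alpha i].
Proof.
apply/forallP => i; have /forallP/(_ i)/eqP <- := valP w.
suff /seq.permP -> : perm_eq
    [tuple letter w (tperm (pos0 k) (pos1 k) j) | j < d] (val w) by [].
apply/tuple_permP; exists (tperm (pos0 k) (pos1 k)).
by congr val; apply: eq_from_tnth => j; rewrite !tnth_mktuple.
Qed.

Definition swap (k : 'I_d.-1) (w : word) : word :=
  Sub [tuple letter w (tperm (pos0 k) (pos1 k) j) | j < d] (swap_subproof k w).

Lemma letter_swap k w j :
  letter (swap k w) j = letter w (tperm (pos0 k) (pos1 k) j).
Proof. by rewrite /letter SubK tnth_mktuple. Qed.

Lemma word_eqP (w v : word) : (forall i, letter w i = letter v i) <-> w = v.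
Proof.
by split=> [h|-> //]; apply: val_inj; apply: eq_from_tnth.
Qed.

End Words.

Section KLR.
Context (F : fieldType) (n : nat) (Q : typeA_quiver n) (alpha : Qplus n).
Local Notation d := (ht alpha).
Local Notation word := (word alpha).

Inductive klr_rel (A : pzRingType) (e : word -> A) (y : 'I_d -> A)
    (psi : 'I_d.-1 -> A) : A -> A -> Prop :=
| KLR_ee w v : klr_rel e y psi (e w * e v) (if w == v then e w else 0)
| KLR_sum_e : klr_rel e y psi (\sum_w e w) 1
| KLR_ye i w : klr_rel e y psi (y i * e w) (e w * y i)
| KLR_psie k w : klr_rel e y psi (psi k * e w) (e (swap k w) * psi k)
| KLR_yy i j : klr_rel e y psi (y i * y j) (y j * y i)
| KLR_ypsi i k : i != pos0 k -> i != pos1 k ->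
    klr_rel e y psi (y i * psi k) (psi k * y i)
| KLR_ypsi1 k w :
    klr_rel e y psi ((y (pos1 k) * psi k - psi k * y (pos0 k)) * e w)
            (if letter w (pos0 k) == letter w (pos1 k) then e w else 0)
| KLR_ypsi2 k w :
    klr_rel e y psi ((psi k * y (pos1 k) - y (pos0 k) * psi k) * e w)
            (if letter w (pos0 k) == letter w (pos1 k) then e w else 0)
| KLR_psi2 k w :
    klr_rel e y psi (psi k ^+ 2 * e w)
      (let a := letter w (pos0 k) in let b := letter w (pos1 k) in
       if a == b then 0
       else if arrow Q a b then (y (pos0 k) - y (pos1 k)) * e w
       else if arrow Q b a then (y (pos1 k) - y (pos0 k)) * e w
       else e w)
| KLR_psi_comm (k l : 'I_d.-1) : (k.+1 < l)%N || (l.+1 < k)%N ->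
    klr_rel e y psi (psi k * psi l) (psi l * psi k)
| KLR_braid (k l : 'I_d.-1) w : l = k.+1 :> nat ->
    klr_rel e y psi ((psi l * psi k * psi l - psi k * psi l * psi k) * e w)
      (let a := letter w (pos0 k) in
       let b := letter w (pos1 k) in
       let c := letter w (pos1 l) in
       if (c == a) && arrow Q a b then e w
       else if (c == a) && arrow Q b a then - e w
       else 0).

Definition klr_gen : Type := (word + 'I_d + 'I_d.-1)%type.

HB.instance Definition _ := Finite.on klr_gen.

Definition klr_free : Type := {malg F[{fmonom klr_gen}]}.

HB.instance Definition _ := GRing.Lalgebra.on klr_free.

Definition free_gen (g : klr_gen) : klr_free := << fmu g >>.
Definition free_e (w : word) : klr_free := free_gen (inl (inl w)).
Definition free_y (i : 'I_d) : klr_free := free_gen (inl (inr i)).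
Definition free_psi (k : 'I_d.-1) : klr_free := free_gen (inr k).

Local Notation free_rel := (klr_rel free_e free_y free_psi).

Definition klr : Type := pres_ring free_rel.

HB.instance Definition _ := GRing.PzRing.on klr.
HB.instance Definition _ := GRing.Lmodule.on klr.

Lemma klr_scaleAl (c : F) (a b : klr) : c *: (a * b) = (c *: a) * b.
Proof. exact: pres_scaleAl. Qed.

Lemma klr_scaleAr (c : F) (a b : klr) : c *: (a * b) = a * (c *: b).
Proof. apply: pres_scaleAr; exact: free_scaleAr. Qed.

Definition klr_e (w : word) : klr := pres_pi free_rel (free_e w).
Definition klr_y (i : 'I_d) : klr := pres_pi free_rel (free_y i).
Definition klr_psi (k : 'I_d.-1) : klr := pres_pi free_rel (free_psi k).

Definition psi_deg (k : 'I_d.-1) (w : word) : int :=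
  let a := letter w (pos0 k) in let b := letter w (pos1 k) in
  if a == b then -2 else if neighbor Q a b then 1 else 0.

(* [klr_hom j a]: [a] lies in the degree [j] component, i.e. in the span of
   the products of homogeneous generators of total degree [j]. *)
Inductive klr_hom : int -> klr -> Prop :=
| KLRhom_e w : klr_hom 0 (klr_e w)
| KLRhom_y i : klr_hom 2 (klr_y i)
| KLRhom_psi k w : klr_hom (psi_deg k w) (klr_psi k * klr_e w)
| KLRhom_mul i j a b : klr_hom i a -> klr_hom j b -> klr_hom (i + j) (a * b)
| KLRhom_0 j : klr_hom j 0
| KLRhom_lin j (c : F) a b :
    klr_hom j a -> klr_hom j b -> klr_hom j (c *: a + b).

Record graded_rep := GradedRep {
  rep_space :> vectType F;
  rep_act : {linear klr -> 'End(rep_space)};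
  rep_act1 : rep_act 1 = \1%VF;
  rep_actM : forall a b, rep_act (a * b) = (rep_act a \o rep_act b)%VF;
  rep_comp : int -> {vspace rep_space};
  rep_comp_span : exists s : seq int, (\sum_(i <- s) rep_comp i)%VS = fullv;
  rep_comp_indep : forall (s : seq int) (u : int -> rep_space), uniq s ->
    (forall i, u i \in rep_comp i) -> \sum_(i <- s) u i = 0 ->
    forall i, i \in s -> u i = 0;
  rep_act_deg : forall j a, klr_hom j a ->
    forall i, (rep_act a @: rep_comp i <= rep_comp (i + j))%VS
}.

Definition irreducible_rep (M : graded_rep) : Prop :=
  fullv != 0%VS :> {vspace M} /\
  forall U : {vspace M}, (forall a, (rep_act M a @: U <= U)%VS) ->
    U = 0%VS \/ U = fullv.

Definition shift_iso (M N : graded_rep) : Prop :=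
  exists g : 'Hom(M, N),
    [/\ lker g = 0%VS, limg g = fullv,
        forall a v, g (rep_act M a v) = rep_act N a (g v) &
        exists s : int, forall i,
          (g @: rep_comp M i)%VS = rep_comp N (i + s)].

Record homog_rep := HomogRep {
  homog_rep_val :> graded_rep;
  homog_rep_irr : irreducible_rep homog_rep_val;
  homog_rep_conc : exists i, rep_comp homog_rep_val i = fullv
}.

Definition weight_edge : rel word := fun w v =>
  [exists k : 'I_d.-1,
    [&& v == swap k w, letter w (pos0 k) != letter w (pos1 k) &
        ~~ neighbor Q (letter w (pos0 k)) (letter w (pos1 k))]].

Definition homog_word (w : word) : bool :=
  [forall r : 'I_d, forall s : 'I_d,
    (r < s)%N && (letter w r == letter w s) ==>
    [exists t : 'I_d, exists u : 'I_d,
      [&& (r < t)%N, (t < u)%N, (u < s)%N,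
          neighbor Q (letter w r) (letter w t) &
          neighbor Q (letter w r) (letter w u)]]].

Definition weight_component (C : {set word}) : bool :=
  [exists w, C == [set v | connect weight_edge w v]].

Definition homog_component (C : {set word}) : bool :=
  weight_component C && [forall w in C, homog_word w].

Section ModuleS.
Variables (C : {set word}) (hC : homog_component C).

Definition S_space : vectType F := {ffun {w : word | w \in C} -> F^o}.

(* 0 if w is not in C *)
Definition S_vec (w : word) : S_space :=
  [ffun u : {w : word | w \in C} => (val u == w)%:R : F^o].

Definition S_gen_vec (g : klr_gen) (w : word) : S_space :=
  match g with
  | inl (inl w') => if w == w' then S_vec w else 0
  | inl (inr i) => 0
  | inr k => if swap k w \in C then S_vec (swap k w) else 0
  end.

Definition S_gen_fun (g : klr_gen) (f : S_space) : S_space :=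
  \sum_u (f : {ffun _ -> F^o}) u *: S_gen_vec g (val u).

Definition S_gen (g : klr_gen) : 'End(S_space) := linfun (S_gen_fun g).

Lemma S_gen_fun_linear g : linear (S_gen_fun g).
Proof.
move=> c f h; rewrite /S_gen_fun scaler_sumr -big_split /=.
by apply: eq_bigr => u _; rewrite !ffunE scalerDl scalerA.
Qed.

HB.instance Definition _ g :=
  GRing.isLinear.Build F S_space S_space _ (S_gen_fun g) (S_gen_fun_linear g).

Lemma S_gen_vecE g w : w \in C -> S_gen g (S_vec w) = S_gen_vec g w.
Proof.
move=> wC; rewrite lfunE /= /S_gen_fun (bigD1 (exist _ w wC)) //=.
rewrite ffunE eqxx scale1r big1 ?addr0 // => u uw.
rewrite ffunE; case: eqP => [E|]; last by rewrite scale0r.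
by case/eqP: uw; apply: val_inj.
Qed.

Lemma S_vec0 w : w \notin C -> S_vec w = 0.
Proof.
move=> wC; apply/ffunP => u; rewrite !ffunE; case: eqP => // E.
by case/negP: wC; rewrite -E (valP u).
Qed.

Lemma S_decomp (f : S_space) : f = \sum_u (f : {ffun _ -> F^o}) u *: S_vec (val u).
Proof.
apply/ffunP => v; rewrite sum_ffunE (bigD1 v) //= !ffunE eqxx.
rewrite big1 => [|u uv]; first by rewrite addr0 /GRing.scale /= mulr1.
by rewrite !ffunE val_eqE eq_sym (negPf uv) scaler0.
Qed.

Lemma S_lfunP (g h : 'End(S_space)) :
  (forall w, w \in C -> g (S_vec w) = h (S_vec w)) -> g = h.
Proof.
move=> E; apply/lfunP => f; rewrite (S_decomp f) !linear_sum /=.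
by apply: eq_bigr => u _; rewrite !linearZ /= E //; exact: (valP u).
Qed.

Definition S_free (a : klr_free) : 'End(S_space) := free_act S_gen a.

Lemma S_freeM a b : S_free (a * b) = (S_free a \o S_free b)%VF.
Proof. by rewrite /S_free free_actM. Qed.

Lemma S_freeMv a b v : S_free (a * b) v = S_free a (S_free b v).
Proof. by rewrite S_freeM comp_lfunE. Qed.

Lemma S_free0 : S_free 0 = 0. Proof. by rewrite /S_free free_act0. Qed.

Lemma S_freeD a b : S_free (a + b) = S_free a + S_free b.
Proof. by rewrite /S_free free_actD. Qed.

Lemma S_free_sum (f : word -> klr_free) :
  S_free (\sum_w f w) = \sum_w S_free (f w).
Proof. by rewrite /S_free free_act_sum. Qed.

Lemma S_freeZ c a : S_free (c *: a) = c *: S_free a.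
Proof. by rewrite /S_free free_actZ. Qed.

Lemma S_freeB a b : S_free (a - b) = S_free a - S_free b.
Proof. by rewrite /S_free free_actB. Qed.

Lemma S_free1 : S_free 1 = \1%VF.
Proof. by rewrite /S_free free_act1. Qed.

Lemma S_free_gen g : S_free (free_gen g) = S_gen g.
Proof. by rewrite /S_free free_act_gen. Qed.

Definition admissible (k : 'I_d.-1) (w : word) : bool :=
  (letter w (pos0 k) != letter w (pos1 k)) &&
  ~~ neighbor Q (letter w (pos0 k)) (letter w (pos1 k)).

Lemma neighborC i j : neighbor Q i j = neighbor Q j i.
Proof. exact: orbC. Qed.

Lemma pos01 (k : 'I_d.-1) : pos0 k != pos1 k.
Proof. by rewrite -val_eqE /= neq_ltn ltnSn. Qed.

Lemma word_split (k : 'I_d.-1) (w : word) : exists s1 s2 : seq 'I_n,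
  val (val w) =
    s1 ++ letter w (pos0 k) :: letter w (pos1 k) :: s2 /\
  val (val (swap k w)) =
    s1 ++ letter w (pos1 k) :: letter w (pos0 k) :: s2.
Proof.
have x0 := letter w (pos0 k).
exists (take k (val (val w))), (drop k.+2 (val (val w))).
have kd : (k.+1 < d)%N := pos1_subproof k.
have sz (v : word) : size (val (val v)) = d by rewrite size_tuple.
have nthE (v : word) (i : 'I_d) : nth x0 (val (val v)) i = letter v i.
  by rewrite /letter (tnth_nth x0).
have E (v : word) : val (val v) = take k (val (val v)) ++ letter v (pos0 k) ::
    letter v (pos1 k) :: drop k.+2 (val (val v)).
  rewrite -{1}(cat_take_drop k (val (val v))); congr (_ ++ _).
  rewrite (drop_nth x0) ?sz ?(ltn_trans _ kd) //.
  by rewrite (drop_nth x0) ?sz // (nthE v (pos0 k)) (nthE v (pos1 k)).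
split; first exact: E.
rewrite E !letter_swap tpermL tpermR.
have nthS i : (i < d)%N -> i != k :> nat -> i != k.+1 ->
    nth x0 (val (val (swap k w))) i = nth x0 (val (val w)) i.
  move=> id ik ik1; rewrite (nthE _ (Ordinal id)) (nthE _ (Ordinal id)).
  by rewrite letter_swap tpermD // -val_eqE /= eq_sym.
congr (_ ++ _ :: _ :: _).
  apply: (@eq_from_nth _ x0) => [|i]; first by rewrite !size_take !sz.
  rewrite size_take sz (ltn_trans _ kd) // => ik.
  rewrite !nth_take // nthS //; first by rewrite (ltn_trans ik) // (ltn_trans _ kd).
    by rewrite neq_ltn ik.
  by rewrite neq_ltn ltnS (ltnW ik).
apply: (@eq_from_nth _ x0) => [|i]; first by rewrite !size_drop !sz.
rewrite size_drop sz ltn_subRL => ik.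
by rewrite !nth_drop nthS //; apply/eqP; lia.
Qed.

Lemma swapK k : involutive (@swap n alpha k).
Proof. by move=> w; apply/word_eqP => i; rewrite !letter_swap tpermK. Qed.

Lemma component_edge w v : w \in C -> weight_edge w v -> v \in C.
Proof.
case/andP: hC => /existsP[w0 /eqP ->] _; rewrite !inE => h1 h2.
exact: connect_trans h1 (connect1 h2).
Qed.

Lemma filter_edge a b w v : neighbor Q a b -> weight_edge w v ->
  filter (pred2 a b) (val (val w)) = filter (pred2 a b) (val (val v)).
Proof.
move=> ab /existsP[k /and3P[/eqP -> xy nxy]].
have [s1 [s2 [-> ->]]] := word_split k w.
move: xy nxy; set x := letter w _; set y := letter w _ => xy nxy.
rewrite !filter_cat /=; congr (_ ++ _).
case: (x =P a) => [xa|_] /=; case: (y =P a) => [ya|_] /=.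
- by rewrite xa ya eqxx in xy.
- by case: (y =P b) => // yb; rewrite xa yb ab in nxy.
- by case: (x =P b) => // xb; rewrite ya xb neighborC ab in nxy.
- case: (x =P b) => [xb|_]; case: (y =P b) => [yb|_] //.
  by rewrite xb yb eqxx in xy.
Qed.

Lemma filter_component a b w v : neighbor Q a b -> w \in C -> v \in C ->
  filter (pred2 a b) (val (val w)) = filter (pred2 a b) (val (val v)).
Proof.
move=> ab; case/andP: hC => /existsP[w0 /eqP ->] _; rewrite !inE.
have E u : connect weight_edge w0 u ->
    filter (pred2 a b) (val (val w0)) = filter (pred2 a b) (val (val u)).
  case/connectP => p; elim: p w0 => [|x p IH] w0 /=; first by move=> _ ->.
  by move=> /andP[e1 e2] E; rewrite (filter_edge ab e1); exact: IH e2 E.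
by move=> /E <- /E <-.
Qed.

Lemma component_homog w : w \in C -> homog_word w.
Proof. by case/andP: hC => _ /forall_inP h /h. Qed.

Lemma component_neq w k : w \in C -> letter w (pos0 k) != letter w (pos1 k).
Proof.
move=> /component_homog /forallP/(_ (pos0 k)) /forallP/(_ (pos1 k)).
case: eqP => //= _; rewrite ltnSn /= => /existsP[t /existsP[u]].
by case/and5P => h1 h2 h3; move: (ltn_trans h2 h3); rewrite /= ltnS leqNgt h1.
Qed.

Lemma component_neq2 w (k l : 'I_d.-1) : l = k.+1 :> nat -> w \in C ->
  letter w (pos0 k) != letter w (pos1 l).
Proof.
move=> kl /component_homog /forallP/(_ (pos0 k)) /forallP/(_ (pos1 l)).
case: eqP => //= _; rewrite kl leqW //= => /existsP[t /existsP[u]].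
by case/and5P => /= h1 h2 h3; lia.
Qed.

Lemma component_swap w k : w \in C -> (swap k w \in C) = admissible k w.
Proof.
move=> wC; apply/idP/idP => [sC|adm]; last first.
  apply: component_edge wC _; apply/existsP; exists k.
  by case/andP: adm => -> ->; rewrite eqxx.
rewrite /admissible component_neq //=; apply/negP => ab.
have := filter_component ab wC sC.
have [s1 [s2 [-> ->]]] := word_split k w.
rewrite !filter_cat /= !eqxx !orbT /=.
move=> /eqP; rewrite eqseq_cat // eqxx /= => /eqP [xy _].
by move: (component_neq k wC); rewrite xy eqxx.
Qed.

Lemma S_e_vec w' w :
  S_free (free_e w') (S_vec w) = if w == w' then S_vec w else 0.
Proof.
rewrite S_free_gen; case: (boolP (w \in C)) => [wC|/S_vec0 E].
  by rewrite S_gen_vecE.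
by rewrite E linear0; case: eqP.
Qed.

Lemma S_y0 i : S_free (free_y i) = 0.
Proof. by apply: S_lfunP => w wC; rewrite S_free_gen S_gen_vecE // lfunE. Qed.

Lemma S_psi_vec k w : w \in C -> S_free (free_psi k) (S_vec w) =
  if admissible k w then S_vec (swap k w) else 0.
Proof. by move=> wC; rewrite S_free_gen S_gen_vecE //= component_swap. Qed.

Lemma S_rel_abs (A : pzRingType) (e : word -> A) (y : 'I_d -> A)
    (psi : 'I_d.-1 -> A) (f : A -> 'End(S_space)) :
  f 1 = \1%VF -> f 0 = 0 -> (forall a b, f (a - b) = f a - f b) ->
  (forall g : word -> A, f (\sum_w g w) = \sum_w f (g w)) ->
  (forall a b, f (a * b) = (f a \o f b)%VF) ->
  (forall w' w, f (e w') (S_vec w) = if w == w' then S_vec w else 0) ->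
  (forall i, f (y i) = 0) ->
  (forall k w, w \in C -> f (psi k) (S_vec w) =
     if admissible k w then S_vec (swap k w) else 0) ->
  forall a b, klr_rel e y psi a b -> f a = f b.
Proof.
move=> f1 f0 fB f_sum fM fe fy fpsi a b.
have fN a' : f (- a') = - f a' by rewrite -sub0r fB f0 sub0r.
have fMv a' b' v : f (a' * b') v = f a' (f b' v) by rewrite fM comp_lfunE.
have y0 i v : f (y i) v = 0 by rewrite fy zero_lfunE.
have MB a' b' v : f (a' - b') v = f a' v - f b' v.
  by rewrite fB add_lfunE opp_lfunE.
have red x w (z : S_space) : (w \in C -> f x (S_vec w) = z) ->
    forall u, f (x * e w) (S_vec u) = if (u == w) && (w \in C) then z else 0.
  move=> h u; rewrite fMv fe; case: eqP => [->|_] /=.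
    by case: (boolP (w \in C)) => [/h //|/S_vec0 E]; rewrite E linear0.
  by rewrite linear0.
have rede w u :
    f (e w) (S_vec u) = if (u == w) && (w \in C) then S_vec w else 0.
  rewrite fe; case: eqP => [->|] //=.
  by case: (boolP (w \in C)) => // /S_vec0.
case=> {a b}.
- move=> w v; apply: S_lfunP => u uC; rewrite fMv (fe v u).
  case: (w =P v) => [<-|wv].
    case: (u =P w) => [//|uw]; rewrite linear0 (fe w u).
    by case: (u =P w).
  rewrite f0 zero_lfunE; case: (u =P v) => [->|_]; last by rewrite linear0.
  by rewrite (fe w v); case: (v =P w) => // E; case: wv.
- apply: S_lfunP => u uC; rewrite f1 f_sum sum_lfunE id_lfunE.
  rewrite (bigD1 u) //= fe eqxx big1 ?addr0 // => w wu.
  by rewrite fe eq_sym (negPf wu).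
- move=> i w; apply/lfunP => v; rewrite !fMv !y0 linear0 //.
- move=> k w; apply: S_lfunP => u uC; rewrite !fMv fe.
  case: eqP => [->|uw].
    case: (boolP (w \in C)) => [wC|/S_vec0 ->]; last by rewrite !linear0.
    rewrite fpsi //; case: ifP => _; last by rewrite linear0.
    by rewrite fe eqxx.
  rewrite linear0 fpsi //; case: ifP => _; last by rewrite linear0.
  by rewrite fe (inj_eq (can_inj (@swapK k))); case: eqP.
- by move=> i j; apply/lfunP => v; rewrite !fMv !y0.
- by move=> i k _ _; apply/lfunP => v; rewrite !fMv !y0 linear0.
- move=> k w; apply: S_lfunP => u uC.
  rewrite (red _ _ 0) => [|wC]; last first.
    by rewrite MB !fMv !y0 linear0 subrr.
  case: (letter w _ =P letter w _) => [h|_]; last first.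
    by rewrite f0 zero_lfunE; case: ifP.
  rewrite rede; case: (boolP (w \in C)) => [wC|_]; last by rewrite andbF.
  by move: (component_neq k wC); rewrite h eqxx.
- move=> k w; apply: S_lfunP => u uC.
  rewrite (red _ _ 0) => [|wC]; last first.
    by rewrite MB !fMv !y0 linear0 subrr.
  case: (letter w _ =P letter w _) => [h|_]; last first.
    by rewrite f0 zero_lfunE; case: ifP.
  rewrite rede; case: (boolP (w \in C)) => [wC|_]; last by rewrite andbF.
  by move: (component_neq k wC); rewrite h eqxx.
- move=> k w; apply: S_lfunP => u uC.
  pose z := if admissible k w then S_vec w else 0.
  rewrite (red _ _ z) => [|wC]; last first.
    rewrite expr2 fMv fpsi // /z; case: ifP => adm; last by rewrite linear0.
    rewrite fpsi ?component_swap // swapK.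
    have -> : admissible k (swap k w) = admissible k w; last by rewrite adm.
    by rewrite /admissible !letter_swap tpermL tpermR neighborC eq_sym.
  rewrite /z /admissible /=; case: (letter w _ =P letter w _) => [h|_] /=.
    by rewrite f0 zero_lfunE; case: ifP.
  have y2 (i j : 'I_d) : f ((y i - y j) * e w) (S_vec u) = 0.
    by rewrite fMv MB !y0 subrr.
  rewrite /neighbor.
  case: (boolP (arrow Q (letter w (pos0 k)) (letter w (pos1 k)))) => _ /=.
    by rewrite y2; case: ifP.
  case: (boolP (arrow Q (letter w (pos1 k)) (letter w (pos0 k)))) => _ /=.
    by rewrite y2; case: ifP.
  by rewrite rede.
- move=> k l kl; apply: S_lfunP => u uC; rewrite !fMv.
  have ne (i j : 'I_d) : (i : nat) != j -> i != j by rewrite -val_eqE.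
  have [ne1 ne2 ne3 ne4] : [/\ pos0 k != pos0 l, pos0 k != pos1 l,
       pos1 k != pos0 l & pos1 k != pos1 l].
    by case/orP: kl => kl; split; apply: ne; rewrite /= neq_ltn ?ltnS;
      rewrite ?kl ?(ltnW kl) ?(ltnW (ltnW kl)) ?orbT.
  have ak : admissible k (swap l u) = admissible k u.
    by rewrite /admissible !letter_swap !tpermD // eq_sym.
  have al : admissible l (swap k u) = admissible l u.
    by rewrite /admissible !letter_swap !tpermD // eq_sym.
  rewrite !fpsi //; case: ifP => hl; case: ifP => hk; rewrite ?linear0 //.
  + rewrite !fpsi ?component_swap // ak al hl hk; congr S_vec.
    apply/word_eqP => i; rewrite !letter_swap; congr letter.
    have tc (x y' z t : 'I_d) : x != z -> x != t -> y' != z -> y' != t ->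
        tperm x y' (tperm z t i) = tperm z t (tperm x y' i).
      move=> xz xt yz yt; case: (tpermP x y' i) => [->|->|/eqP ix /eqP iy].
      * by rewrite !(@tpermD _ z t) 1?eq_sym // tpermL.
      * by rewrite !(@tpermD _ z t) 1?eq_sym // tpermR.
      by case: (tpermP z t i) => [_|_|_ _]; rewrite tpermD // eq_sym.
    by rewrite tc // eq_sym.
  + by rewrite fpsi ?component_swap // ak hk.
  + by rewrite fpsi ?component_swap // al hl.
- move=> k l w kl; apply: S_lfunP => u uC.
  have p10 : pos1 k = pos0 l by apply: val_inj.
  have ne1 : pos0 k != pos0 l by rewrite -p10 pos01.
  have ne2 : pos0 k != pos1 l by rewrite -val_eqE /= kl neq_ltn leqnSn.
  have ne3 : pos0 l != pos1 l := pos01 l.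
  pose a := letter w (pos0 k); pose b := letter w (pos0 l).
  pose c := letter w (pos1 l).
  pose com (x y : 'I_n) := (x != y) && ~~ neighbor Q x y.
  have comC x z : com x z = com z x by rewrite /com eq_sym neighborC.
  have admE r v : admissible r v = com (letter v (pos0 r)) (letter v (pos1 r)) by [].
  have sk v : [/\ letter (swap k v) (pos0 k) = letter v (pos0 l),
                  letter (swap k v) (pos0 l) = letter v (pos0 k) &
                  letter (swap k v) (pos1 l) = letter v (pos1 l)].
    by rewrite !letter_swap p10 tpermL tpermR tpermD.
  have sl v : [/\ letter (swap l v) (pos0 k) = letter v (pos0 k),
                  letter (swap l v) (pos0 l) = letter v (pos1 l) &
                  letter (swap l v) (pos1 l) = letter v (pos0 l)].
    by rewrite !letter_swap tpermL tpermR tpermD // eq_sym.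
  have E1 : w \in C -> f (psi l * psi k * psi l) (S_vec w) =
      if [&& com a b, com a c & com b c] then S_vec (swap l (swap k (swap l w))) else 0.
    move=> wC; rewrite !fMv fpsi // admE -/b -/c.
    case h1: (com b c); last by rewrite !linear0 !andbF.
    have [s1 s2 s3] := sl w.
    rewrite fpsi ?component_swap ?admE // p10 s1 s2 -/a -/c.
    case h2: (com a c); last by rewrite !linear0 ?andbF.
    have [t1 t2 t3] := sk (swap l w).
    rewrite fpsi ?component_swap ?admE ?p10 ?s1 ?s2 //.
    by rewrite t2 t3 s1 s3 -?/a -?/b ?h1 ?h2 ?andbT.
  have E2 : w \in C -> f (psi k * psi l * psi k) (S_vec w) =
      if [&& com a b, com a c & com b c] then S_vec (swap l (swap k (swap l w))) else 0.
    move=> wC; rewrite !fMv fpsi // admE p10 -/a -/b.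
    case h1: (com a b); last by rewrite !linear0.
    have [s1 s2 s3] := sk w.
    rewrite fpsi ?component_swap ?admE ?p10 // s2 s3 -/a -/c.
    case h2: (com a c); last by rewrite !linear0.
    have [t1 t2 t3] := sl (swap k w).
    rewrite fpsi ?component_swap ?admE ?p10 ?s2 ?s3 //.
    rewrite t1 t2 s1 s3 -/b -/c; case: (com b c) => //=; congr S_vec.
    apply/word_eqP => i; rewrite !letter_swap p10; congr letter.
    have tt (x z' z j : 'I_d) : x != z' -> x != z -> z' != z ->
        tperm x z' (tperm z' z (tperm x z' j)) = tperm z' z (tperm x z' (tperm z' z j)).
      move=> xy xz yz.
      have D1 : tperm x z' z = z by rewrite tpermD.
      have D2 : tperm z' z x = x by rewrite tpermD // eq_sym.
      case: (tpermP x z' j) => [->|->|/eqP jx /eqP jy].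
      - by rewrite D2 !tpermL D1.
      - by rewrite D2 !tpermL D1 tpermR.
      case: (tpermP z' z j) => [E|_|_ /eqP jz].
      - by rewrite E eqxx in jy.
      - by rewrite !tpermR D2.
      by rewrite !tpermD // eq_sym.
    exact: tt.
  rewrite (red _ _ 0) => [|wC]; last by rewrite MB E1 // E2 // subrr.
  rewrite /= p10 -/a -/b -/c.
  case: (boolP (u == w)) => [/eqP uw|uw].
    have := component_neq2 kl uC; rewrite uw -/a -/c eq_sym => /negPf ->.
    by rewrite andFb f0 zero_lfunE if_same.
  have z0 : f (e w) (S_vec u) = 0 by rewrite fe (negPf uw).
  by case: ifP => _; [|case: ifP => _]; rewrite ?fN ?f0 ?opp_lfunE ?z0 ?oppr0 ?zero_lfunE.
Qed.

Lemma S_relP a b : free_rel a b -> S_free a = S_free b.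
Proof.
apply: (@S_rel_abs klr_free).
- exact: S_free1.
- exact: S_free0.
- exact: S_freeB.
- exact: S_free_sum.
- exact: S_freeM.
- exact: S_e_vec.
- exact: S_y0.
- exact: S_psi_vec.
Qed.

Lemma S_ideal a : rel_ideal free_rel a -> S_free a = 0.
Proof.
elim=> {a} [a b /S_relP E | | a b _ ha _ hb | x a _ ha | x a _ ha].
- by rewrite S_freeB E subrr.
- by rewrite S_free0.
- by rewrite S_freeD ha hb addr0.
- by rewrite S_freeM ha comp_lfun0r.
- by rewrite S_freeM ha comp_lfun0l.
Qed.

Definition S_act (x : klr) : 'End(S_space) := S_free (pres_repr x).

Lemma S_act_pi a : S_act (pres_pi free_rel a) = S_free a.
Proof.
apply/eqP; rewrite -subr_eq0 /S_act -S_freeB; apply/eqP/S_ideal.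
by apply/pres_piP; rewrite pres_reprK.
Qed.

Lemma S_act_linear : linear S_act.
Proof.
move=> c x y; rewrite -[x]pres_reprK -[y]pres_reprK.
rewrite [c *: (pres_pi _ _ : klr)]pres_piZ -[_ + _]pres_piD !S_act_pi.
by rewrite S_freeD S_freeZ.
Qed.

HB.instance Definition _ := GRing.isLinear.Build F klr 'End(S_space) _
  S_act S_act_linear.

Lemma S_act1 : S_act 1 = \1%VF.
Proof. by rewrite -pres_pi1 S_act_pi S_free1. Qed.

Lemma S_actM x y : S_act (x * y) = (S_act x \o S_act y)%VF.
Proof.
by rewrite -[x]pres_reprK -[y]pres_reprK -pres_piMr !S_act_pi S_freeM.
Qed.

Lemma S_act_e w' w : S_act (klr_e w') (S_vec w) = if w == w' then S_vec w else 0.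
Proof. by rewrite S_act_pi S_e_vec. Qed.

Lemma S_act_y i : S_act (klr_y i) = 0.
Proof. by rewrite S_act_pi S_y0. Qed.

Lemma S_act_psi k w : w \in C -> S_act (klr_psi k) (S_vec w) =
  if swap k w \in C then S_vec (swap k w) else 0.
Proof. by move=> wC; rewrite S_act_pi S_free_gen S_gen_vecE. Qed.

Definition S_comp (i : int) : {vspace S_space} :=
  if i == 0 then fullv else 0%VS.

Lemma S_comp_span :
  exists s : seq int, (\sum_(i <- s) S_comp i)%VS = fullv.
Proof. by exists [:: 0]; rewrite big_seq1. Qed.

Lemma S_comp_indep (s : seq int) (u : int -> S_space) : uniq s ->
  (forall i, u i \in S_comp i) -> \sum_(i <- s) u i = 0 ->
  forall i, i \in s -> u i = 0.
Proof.
move=> us hu hs.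
have u0 i : i != 0 -> u i = 0.
  by move=> i0; move: (hu i); rewrite /S_comp (negPf i0) memv0 => /eqP.
move=> i is_; case: (i =P 0) => [i0|/eqP /u0 //].
rewrite -hs (bigD1_seq i) //= big1 ?addr0 // => j ji.
by apply: u0; rewrite -i0.
Qed.

Lemma S_act_hom j a : klr_hom j a -> j != 0 -> S_act a = 0.
Proof.
elim=> {j a} [w //|i|k w|i j a b _ IHa _ IHb|j|j c a b _ IHa _ IHb].
- by rewrite S_act_y.
- move=> deg; apply: S_lfunP => u uC.
  rewrite S_actM comp_lfunE zero_lfunE (S_act_e w u).
  case: (u =P w) => [uw|_]; last by rewrite linear0.
  rewrite uw in uC *; rewrite S_act_psi // component_swap //.
  case: ifP => // /andP[/negPf ne /negPf nn].
  by move: deg; rewrite /psi_deg /= ne nn eqxx.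
- move=> ij; rewrite S_actM; case: (boolP (i == 0)) => [/eqP i0|i0].
    by rewrite IHb ?comp_lfun0r //; move: ij; rewrite i0 add0r.
  by rewrite IHa // comp_lfun0l.
- by rewrite linear0.
- by move=> j0; rewrite linearP /= IHa // IHb // scaler0 addr0.
Qed.

Lemma S_act_deg j a : klr_hom j a ->
  forall i, (S_act a @: S_comp i <= S_comp (i + j))%VS.
Proof.
move=> ha i; case: (boolP (j == 0)) => [/eqP ->|j0].
  by rewrite addr0 /S_comp; case: ifP => _; rewrite ?subvf // limg0 subvv.
by rewrite (S_act_hom ha j0) lim0g sub0v.
Qed.

Definition S_rep : graded_rep :=
  @GradedRep S_space S_act S_act1 S_actM S_comp
    S_comp_span S_comp_indep S_act_deg.

End ModuleS.

Definition given_by_length (M : graded_rep) (k : nat) : Prop :=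
  exists (C : {set word}) (hC : homog_component C),
    shift_iso M (S_rep hC) /\ {in C, forall w, size (val (val w)) = k}.

End KLR.

(* The type of classes, up to isomorphism and degree shift, of the homogeneous
   representations of R, the direct sum of the R_alpha. *)

Section Classes.
Context (F : fieldType) (n : nat) (Q : typeA_quiver n).

Definition pre_class : Type :=
  {alpha : Qplus n & homog_rep F Q alpha -> Prop}.

Definition rep_class : Type :=
  {c : pre_class | exists alpha (M : homog_rep F Q alpha),
     c = existT _ alpha (fun N : homog_rep F Q alpha => shift_iso M N)}.

Definition class_of (alpha : Qplus n) (M : homog_rep F Q alpha) : rep_class :=
  exist _ (existT _ alpha (fun N : homog_rep F Q alpha => shift_iso M N))
    (ex_intro _ alpha (ex_intro _ M erefl)).

Lemma shift_iso_refl alpha (M : graded_rep F Q alpha) : shift_iso M M.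
Proof.
exists \1%VF; split=> [||a v|].
- by apply/eqP/lker0P => x y; rewrite !id_lfunE.
- by rewrite lim1g.
- by rewrite !id_lfunE.
by exists 0 => i; rewrite lim1g addr0.
Qed.

Lemma shift_iso_sym alpha (M N : graded_rep F Q alpha) :
  shift_iso M N -> shift_iso N M.
Proof.
case=> g [/eqP g_inj g_surj gP [s gs]].
have gK v : (g^-1)%VF (g v) = v by exact: lker0_lfunK.
have gVK v : g ((g^-1)%VF v) = v.
  by apply: limg_lfunVK; rewrite g_surj memvf.
exists (g^-1)%VF; split=> [||a v|].
- by apply/eqP/lker0P => x y E; rewrite -[x]gVK E gVK.
- apply/eqP; rewrite eqEsubv subvf; apply/subvP => v _.
  by rewrite -[v]gK memv_img // memvf.
- by rewrite -{1}[v]gVK -gP gK.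
exists (- s) => i; rewrite -[in LHS](subrK s i) -gs -limg_comp.
by rewrite lker0_compVf // lim1g.
Qed.

Lemma shift_iso_trans alpha (M N P : graded_rep F Q alpha) :
  shift_iso M N -> shift_iso N P -> shift_iso M P.
Proof.
case=> g [/eqP g_inj g_surj gP [s gs]] [h [/eqP h_inj h_surj hP [t ht]]].
exists (h \o g)%VF; split=> [||a v|].
- apply/eqP/lker0P => x y; rewrite !comp_lfunE.
  by move/(lker0P h_inj)/(lker0P g_inj).
- by rewrite limg_comp g_surj h_surj.
- by rewrite !comp_lfunE gP hP.
by exists (s + t) => i; rewrite limg_comp gs ht addrA.
Qed.

Lemma class_ofP alpha (M N : homog_rep F Q alpha) :
  class_of M = class_of N <-> shift_iso M N.
Proof.
split=> [/(congr1 (@proj1_sig _ _))/= E|MN].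
  have {}E := Eqdep_dec.inj_pair2_eq_dec _ (@eq_comparable (Qplus n)) _ _ _ _ E.
  by rewrite (congr1 (@^~ N) E); exact: shift_iso_refl.
apply: eq_exist; congr existT; apply: funext => P; apply: propext.
split; last exact: shift_iso_trans.
exact: shift_iso_trans (shift_iso_sym MN).
Qed.

Definition rep_class_of_length (k : nat) : Type :=
  {c : rep_class | exists alpha (M : homog_rep F Q alpha),
     c = class_of M /\ given_by_length M k}.

End Classes.

(* Main.v *)
(* A homogeneous representation is a module S(C) (Kleshchev--Ram): if the
   representation is concentrated in one degree, the y_r act by 0, and the
   relations then say that the weights are homogeneous words and that transport
   of a weight vector along the weight graph does not depend on the path.
   A homogeneous component is a class of words modulo commutations; in type A it
   is determined by its projections to the pairs {c, c+1}, and homogeneity means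
   that these projections alternate.  Such a class has a unique normal form
   (a_1 a_1-1 .. b_1)(a_2 a_2-1 .. b_2)..  with a_1 < a_2 < .. and
   b_1 < b_2 < .. , and the run (a .. b) is recorded by a peak which follows
   a + 1 rises and b - 1 falls, so that its height minus 1 is the length of the
   run; the remaining peaks of the Dyck path have height 1. *)

From HB Require Import structures.
Require Import Defs.
From mathcomp Require Import all_boot all_algebra.
From mathcomp Require Import perm boolp finmap monalg zify.

Set Implicit Arguments.
Unset Strict Implicit.
Unset Printing Implicit Defensive.

Import GRing.Theory.

(** * Words modulo commutations *)

Section Traces.
Implicit Types (a b c x y : nat) (w u s t : seq nat).

(** Commutation equivalence is defined by equality of projections, not by reachability through
    swaps: alternation and uniqueness of the normal form can then be read off one pair of letters at
    a time, and [trace_eq_ind] is the way back to swaps. The vertices become the letters 1..n, so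
    that 0 and n+1 act as walls: alternation on {0, 1} and on {n, n+1} says that the extreme letters
    occur at most once, which is what homogeneity forces at the two ends of the diagram. On the
    algebra side, the obstacle is path independence of the transport. It is met by fixing one
    canonical path for each target word and checking that every further swap agrees with it. The
    transported vectors define a nonzero map from S(C) to the representation, which is an
    isomorphism because source and target are both irreducible. *)

Definition adjacent a b := (a.+1 == b) || (b.+1 == a).
Definition commuting a b := (a != b) && ~~ adjacent a b.
Definition proj c w := [seq x <- w | (x == c) || (x == c.+1)].
Definition trace_eq w u := perm_eq w u /\ forall c, proj c w = proj c u.

Lemma commutingC a b : commuting a b = commuting b a.
Proof. by rewrite /commuting /adjacent; lia. Qed.

Lemma proj_cat c w u : proj c (w ++ u) = proj c w ++ proj c u.
Proof. exact: filter_cat. Qed.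

Lemma trace_eq_refl w : trace_eq w w.
Proof. by split. Qed.

Lemma trace_eq_sym w u : trace_eq w u -> trace_eq u w.
Proof. by case=> pe pr; split=> [|c]; rewrite 1?perm_sym. Qed.

Lemma trace_eq_trans w u s : trace_eq w u -> trace_eq u s -> trace_eq w s.
Proof.
case=> pe pr [pe' pr']; split; first exact: perm_trans pe pe'.
by move=> c; rewrite pr.
Qed.

Lemma trace_eq_cat w w' u u' :
  trace_eq w w' -> trace_eq u u' -> trace_eq (w ++ u) (w' ++ u').
Proof.
case=> pe pr [pe' pr']; split; first exact: perm_cat.
by move=> c; rewrite !proj_cat pr pr'.
Qed.

Lemma trace_eq_catI s w u : trace_eq (s ++ w) (s ++ u) -> trace_eq w u.
Proof.
case; rewrite perm_cat2l => pe pr; split=> // c.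
by move: (pr c); rewrite !proj_cat => /eqP; rewrite eqseq_cat // => /andP[_ /eqP].
Qed.

Lemma trace_eq_swap a b : commuting a b -> trace_eq [:: a; b] [:: b; a].
Proof.
move=> ab; split; first by rewrite -[[:: b; a]]/([:: b] ++ [:: a]) perm_sym perm_catC.
by move=> c; rewrite /proj /=; move: ab; rewrite /commuting /adjacent;
   do 2 (case: ifP => ?) => //; lia.
Qed.

Lemma trace_eq_move a s : all (commuting a) s -> trace_eq (a :: s) (rcons s a).
Proof.
elim: s => [|b s IH] /= => [_|/andP[ab /IH H]]; first exact: trace_eq_refl.
apply: (@trace_eq_trans _ (b :: a :: s)).
  exact: (@trace_eq_cat [:: a; b] [:: b; a] s s (trace_eq_swap ab) (trace_eq_refl _)).
exact: (@trace_eq_cat [:: b] [:: b] _ _ (trace_eq_refl _) H).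
Qed.

(** A letter [b] of [s] adjacent to [a] would come before the first [a] in the projection to the
    pair formed by [a] and [b], while on the left that projection starts with [a]. *)
Lemma trace_eq_head a w s t : trace_eq (a :: w) (s ++ a :: t) -> a \notin s ->
  all (commuting a) s /\ trace_eq w (s ++ t).
Proof.
move=> [pe pr] as_.
have Hc : all (commuting a) s.
  apply/allP => b bs; apply/andP; split.
    by apply: contraNneq as_ => ->.
  apply/negP => ab.
  pose c := minn a b.
  have ac : (a == c) || (a == c.+1) by move: ab; rewrite /adjacent /c; lia.
  have bc : (b == c) || (b == c.+1) by move: ab; rewrite /adjacent /c; lia.
  have := pr c; rewrite proj_cat /= ac.
  case E : (proj c s) => [|h r] /=.
    have : b \in proj c s by rewrite mem_filter bc.
    by rewrite E.
  case=> ah _; have : h \in proj c s by rewrite E mem_head.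
  by rewrite mem_filter -ah (negPf as_) andbF.
split=> //; split.
  by rewrite -(perm_cons a) (perm_trans pe) // -[a :: t]cat1s perm_catCA.
move=> c; have := pr c; rewrite !proj_cat /=.
case: ifP => // ac.
have -> : proj c s = [::].
  apply/eqP; rewrite -[_ == _]negbK -has_filter; apply/hasPn => b bs.
  have := allP Hc _ bs; rewrite /commuting /adjacent.
  by apply: contraL => bc; rewrite negb_and; lia.
by case.
Qed.

Lemma split_first a u : a \in u -> exists s t, u = s ++ a :: t /\ a \notin s.
Proof.
elim: u => // b u IH; rewrite in_cons; case: eqVneq => [<- _|ab /= /IH].
  by exists [::], u.
case=> s [t [-> as_]]; exists (b :: s), t; split=> //.
by rewrite in_cons negb_or ab.
Qed.

Lemma trace_eq_cons_split a w u : trace_eq (a :: w) u ->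
  exists s t, [/\ u = s ++ a :: t, a \notin s, all (commuting a) s &
                  trace_eq w (s ++ t)].
Proof.
move=> H; have au : a \in u by case: H => /perm_mem <- _; rewrite mem_head.
have [s [t [E as_]]] := split_first au.
rewrite E in H *; have [h1 h2] := trace_eq_head H as_.
by exists s, t.
Qed.

(** Equal projections imply reachability by swaps: the first letter of [w] is bubbled to its first
    occurrence in [u] across letters that all commute with it, and the tails are treated
    recursively. *)
Lemma trace_eq_ind (P : seq nat -> Prop) :
  (forall s x y t, commuting x y -> P (s ++ x :: y :: t) -> P (s ++ y :: x :: t)) ->
  forall w u, trace_eq w u -> P w -> P u.
Proof.
(* The prefix is generalised because [P] concerns the whole word while the induction strips first
   letters. *)
move=> step w u H; rewrite -[w]cat0s -[u]cat0s; move: [::] => pre.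
elim: w u H pre => [|a w IH] u H pre.
  by have := perm_size (proj1 H); case: u H.
move=> Pw; have [s [t [-> as_ cs /IH {}IH]]] := trace_eq_cons_split H.
have := IH (rcons pre a); rewrite !cat_rcons => /(_ Pw) {IH Pw}.
elim: s pre cs {as_ H} => [//|b s IHs] pre /= /andP[ab cs] /(step _ _ _ _ ab) Ps.
by have := IHs (rcons pre b) cs; rewrite !cat_rcons; apply.
Qed.

End Traces.

(** * Homogeneity as alternation of the projections *)

Section Alternating.
Implicit Types (a b c x y : nat) (w u s t : seq nat).

Definition homogeneous_seq w := forall a s t r,
  w = s ++ a :: t ++ a :: r -> 1 < count (adjacent a) t.

Definition alternating w :=
  forall c, sorted (fun x y => x != y) (proj c w).

Lemma alternating_catl w u : alternating (w ++ u) -> alternating w.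
Proof. by move=> h c; have := h c; rewrite proj_cat => /cat_sorted2[]. Qed.

Lemma alternating_catr w u : alternating (w ++ u) -> alternating u.
Proof. by move=> h c; have := h c; rewrite proj_cat => /cat_sorted2[]. Qed.

Lemma homogeneous_cat s t r :
  homogeneous_seq (s ++ t ++ r) -> homogeneous_seq t.
Proof.
move=> h a s' t' r' E; apply: (h a (s ++ s') t' (r' ++ r)).
by rewrite E -!catA /= -!catA.
Qed.

Lemma count_gt1_split a w : 1 < count_mem a w ->
  exists s t r, w = s ++ a :: t ++ a :: r /\ a \notin t.
Proof.
move=> h; have aw : a \in w by rewrite -has_pred1 has_count; lia.
have [s [v [E as_]]] := split_first aw; rewrite {}E in h *.
have av : a \in v.
  by move: h; rewrite count_cat (count_memPn as_) /= eqxx add0n add1n ltnS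
    -has_count has_pred1.
have [t [r [-> at_]]] := split_first av.
by exists s, t, r.
Qed.

Lemma count_adjacent a t : count (adjacent a) t =
  count_mem a.+1 t + count (fun x => x.+1 == a) t.
Proof. by elim: t => //= x t ->; rewrite /adjacent (eq_sym a.+1); lia. Qed.

(** Between two consecutive [c.+1] the two required neighbours can only be [c.+2], since [c] is
    absent. The stretch between them avoids [c.+1], so the situation repeats one letter higher,
    until the largest letter is passed. *)
Lemma homogeneous_count_succ c w :
  homogeneous_seq w -> c \notin w -> count_mem c.+1 w <= 1.
Proof.
pose N := \max_(x <- w) x; have : all (leq^~ N) w.
  by apply/allP => x xw; by rewrite /=; exact: (leq_bigmax_seq x xw isT).
move: N => N; move: {2}(N - c) (leqnn (N - c)) => m.
elim: m c w => [|m IH] c w mN wN hw cw; rewrite leqNgt; apply/negP => h.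
  have : c.+1 \in w by rewrite -has_pred1 has_count; lia.
  by move/(allP wN); lia.
have [s [t [r [E nt]]]] := count_gt1_split h.
have := hw _ _ _ _ E; rewrite count_adjacent.
have -> : count (fun x => x.+1 == c.+1) t = 0.
  apply/eqP; rewrite -leqn0 leqNgt -has_count; apply/hasPn => x xt.
  apply: contraNneq cw => -[<-]; rewrite E !(mem_cat, in_cons) xt ?orbT //.
have ht : homogeneous_seq t.
  apply: (@homogeneous_cat (rcons s c.+1) t (c.+1 :: r)); by rewrite cat_rcons -E.
have tN : all (leq^~ N) t by move: wN; rewrite E !all_cat /= all_cat => /and5P[].
by have := IH c.+1 t _ tN ht nt; lia.
Qed.

(** Mirror image of [homogeneous_count_succ]: the descent is stopped by the absent letter 0. *)
Lemma homogeneous_count_pred c w :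
  homogeneous_seq w -> 0 \notin w -> c.+1 \notin w -> count_mem c w <= 1.
Proof.
elim: c w => [|c IH] w hw w0 cw; rewrite leqNgt; apply/negP => h.
  by move: h; rewrite (count_memPn w0).
have [s [t [r [E nt]]]] := count_gt1_split h.
have sub x : x \in t -> x \in w by move=> xt; rewrite E !(mem_cat, in_cons) xt ?orbT.
have := hw _ _ _ _ E; rewrite count_adjacent.
have ht : homogeneous_seq t.
  apply: (@homogeneous_cat (rcons s c.+1) t (c.+1 :: r)); by rewrite cat_rcons -E.
have := IH t ht (contra (sub _) w0) nt.
rewrite (count_memPn (contra (sub _) cw)) (eq_count (a2 := pred1 c)); first lia.
by move=> x /=; lia.
Qed.

Lemma sorted_filter_neq (P : pred nat) w :
  (forall s a t r, w = s ++ a :: t ++ a :: r -> P a -> has P t) ->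
  sorted (fun x y => x != y) (filter P w).
Proof.
elim: w => //= b w IH h.
have {}IH := IH (fun s a t r E => h (b :: s) a t r (congr1 (cons b) E)).
case: ifP => // Pb; case E : (filter P w) IH => [//|x u] /= ->; rewrite andbT.
apply/eqP => bx.
have [t [r [Ew nt]]] : exists t r, w = t ++ x :: r /\ ~~ has P t.
  elim: w E {h} => //= y w IH; case: ifP => [Py [-> _]|Py /IH].
    by exists [::], w.
  by case=> t [r [-> nt]]; exists (y :: t), r; rewrite /= Py.
by case/negP: nt; apply: (h [::] b t r) => //=; rewrite Ew bx.
Qed.

(** If two equal letters [a] were consecutive in the projection to {c, c+1}, the stretch between
    them would lack the neighbour of [a] inside this pair and also [a] itself. The two required
    neighbours would then be two copies of the neighbour outside the pair, which the preceding
    counts exclude. *)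
Lemma homogeneous_alternating w :
  0 \notin w -> homogeneous_seq w -> alternating w.
Proof.
move=> w0 hw c; apply: sorted_filter_neq => s a t r E Pa.
apply/negPn/negP => nt.
have sub x : x \in t -> x \in w by move=> xt; rewrite E !(mem_cat, in_cons) xt ?orbT.
have ht : homogeneous_seq t.
  apply: (@homogeneous_cat (rcons s a) t (a :: r)); by rewrite cat_rcons -E.
have ct : c \notin t by apply: contra nt => ct; apply/hasP; exists c; rewrite ?eqxx.
have ct' : c.+1 \notin t.
  by apply: contra nt => ct'; apply/hasP; exists c.+1; rewrite ?eqxx ?orbT.
have := hw _ _ _ _ E; rewrite count_adjacent; case/orP: Pa => /eqP ->.
  rewrite (count_memPn ct'); case: c ct {ct' nt} => [|c] ct.
    by rewrite (eq_count (a2 := pred0)) ?count_pred0.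
  rewrite (eq_count (a2 := pred1 c)); last by move=> x /=; lia.
  by have := homogeneous_count_pred ht (contra (sub _) w0) ct; lia.
rewrite (eq_count (a1 := fun x => x.+1 == c.+1) (a2 := pred1 c)).
  by rewrite (count_memPn ct); have := homogeneous_count_succ ht ct'; lia.
by move=> x /=; lia.
Qed.

(** Alternation on {a-1, a} and on {a, a+1} each supplies one neighbour between two occurrences of
    [a]. Positivity of the letters gives [a.-1] its meaning. *)
Lemma alternating_homogeneous w :
  0 \notin w -> alternating w -> homogeneous_seq w.
Proof.
move=> w0 aw a s t r E.
have between c b : (a == c) || (a == c.+1) -> (b == c) || (b == c.+1) -> b != a ->
    b \in t.
  move=> ac bc ba; have := aw c; rewrite E proj_cat /= ac proj_cat /= ac.
  move=> /cat_sorted2[_]; case Et : (proj c t) => [|x v] /=; first by rewrite eqxx.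
  case/andP => ax _.
  have : x \in proj c t by rewrite Et mem_head.
  by rewrite mem_filter => /andP[xc xt]; have <- : x = b by lia.
have a0 : 0 < a.
  by rewrite lt0n; apply: contraNneq w0 => <-; rewrite E mem_cat mem_head orbT.
have /between : (a == a) || (a == a.+1) by rewrite eqxx.
move=> /(_ a.+1); rewrite eqxx orbT => /(_ isT) => h1.
have /between : (a == a.-1) || (a == a.-1.+1) by rewrite prednK // eqxx orbT.
move=> /(_ a.-1); rewrite eqxx => /(_ isT) h2.
have e : count (fun x => x.+1 == a) t = count_mem a.-1 t.
  by apply: eq_count => x /=; lia.
have p b : b \in t -> 0 < count_mem b t by rewrite -has_count has_pred1.
have p1 := p _ (h1 _); have p2 := p _ (h2 _).
by rewrite count_adjacent e -addn1 leq_add ?p1 ?p2 //; lia.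
Qed.

Lemma trace_eq_alternating w u : trace_eq w u -> alternating w -> alternating u.
Proof. by case=> _ pr aw c; rewrite -pr. Qed.

End Alternating.

(** * Normal forms *)

Section NormalForm.
Implicit Types (a b c x y A B N k m : nat) (w u s t ks : seq nat).

(* A Dyck path is encoded by the list [ks] of the numbers of rises before each
   fall; [A] rises and [B] falls have already been read.  A fall that ends a peak
   contributes the run [A + k - 1, .., B + 1], which is empty when the peak has
   height 1. *)
Fixpoint normal_form B A ks : seq nat :=
  if ks is k :: ks' then
    (if 0 < k then rev (iota B.+1 (A + k - B.+1)) else [::])
      ++ normal_form B.+1 (A + k) ks'
  else [::].

Fixpoint ballot B A ks : bool :=
  if ks is k :: ks' then (B < A + k) && ballot B.+1 (A + k) ks' else A == B.

(* The third condition says that the word may follow a run starting with [A - 1]: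
   a letter of that run must meet its successor before it occurs again. *)
Definition normalizable N B A w :=
  [/\ all (fun x => B < x < N) w, alternating w &
      forall c, B < c < A -> head c.+1 (proj c w) = c.+1].

Lemma proj_run c b m : proj c (rev (iota b m)) =
  (if b <= c.+1 < b + m then [:: c.+1] else [::])
    ++ (if b <= c < b + m then [:: c] else [::]).
Proof.
elim: m => [|m IH].
  by rewrite /= addn0 !ifN //; lia.
rewrite -addn1 iotaD rev_cat /= [proj c _]/= -/(proj c _) IH.
by do 5 (case: ifP => ? /=);
  first [done | exfalso; lia | congr [:: _]; lia | congr [:: _; _]; lia].
Qed.

Lemma normal_form_gt B A ks x : x \in normal_form B A ks -> B < x.
Proof.
elim: ks B A => //= k ks IH B A; rewrite mem_cat => /orP[|/IH]; last by lia.
by case: ifP => // _; rewrite mem_rev mem_iota => /andP[].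
Qed.

Lemma ballot_le B A ks : ballot B A ks -> A <= B + size ks.
Proof.
elim: ks B A => [|k ks IH] B A /=; first by move=> /eqP ->; rewrite addn0.
by case/andP=> _ /IH; lia.
Qed.

Lemma sorted_cons_head c s : sorted (fun x y => x != y) s -> head c.+1 s = c.+1 ->
  sorted (fun x y => x != y) (c :: s).
Proof. by case: s => //= x s -> ->; rewrite andbT; lia. Qed.

Lemma proj_head_succ c w : c \notin w -> head c.+1 (proj c w) = c.+1.
Proof.
move=> cw; case E : (proj c w) => [//|x s] /=.
have : x \in proj c w by rewrite E mem_head.
rewrite mem_filter => /andP[/orP[]/eqP-> //].
by rewrite (negPf cw).
Qed.

(** Prepending a run adds c+1, c in front of the projection to {c, c+1}, or [c] alone when [c] is
    its top letter. Alternation survives exactly when the old projection is empty or starts with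
    c+1; the default value of [head] covers the empty case. *)
Lemma normal_form_normalizable B A ks : B <= A -> ballot B A ks ->
  normalizable (B + size ks) B A (normal_form B A ks).
Proof.
elim: ks B A => [|k ks IH] B A BA /=; first by move=> /eqP ->; split=> // c; lia.
case/andP=> BAk bal; have [] := IH _ _ BAk bal; rewrite addSnnS.
have := ballot_le bal; rewrite addSnnS; set w := normal_form _ _ _ => leN letters alt hd.
(* The induction hypothesis starts at [B.+2]; the missing value [B.+1] is free because this letter
   no longer occurs in [w]. *)
have headw c : B < c < A + k -> head c.+1 (proj c w) = c.+1.
  move=> cB; case: (eqVneq c B.+1) => [->|ne]; last by apply: hd; lia.
  by apply: proj_head_succ; apply/negP => /normal_form_gt; rewrite ltnn.
have projB : proj B w = [::].
  apply/eqP; rewrite -[_ == _]negbK -has_filter; apply/hasPn => x /(allP letters).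
  by lia.
case: ifP => k0; last first.
  split=> //; last by move=> c cA; apply: headw; lia.
  by apply/allP => x /(allP letters); lia.
split.
- rewrite all_cat; apply/andP; split; apply/allP => x.
    by rewrite mem_rev mem_iota; lia.
  by move/(allP letters); lia.
- move=> c; rewrite proj_cat proj_run.
  have -> : B.+1 + (A + k - B.+1) = A + k by lia.
  case: (ltnP c.+1 (A + k)) => cA.
    rewrite andbT (ltnW cA) andbT; case: (ltngtP c B) => cB.
    + by rewrite ifN ?ifN; first [exact: alt | lia].
    + rewrite ifT; last by lia.
      rewrite -cat1s /=; apply/andP; split; first by lia.
      by apply: (@sorted_cons_head c) => //; apply: headw; lia.
    + by rewrite ifT ?cB ?projB //; lia.
  rewrite andbF /=; case: ifP => cB; last exact: alt.
  by apply: sorted_cons_head => //; apply: headw; lia.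
move=> c cA; rewrite proj_cat proj_run ifT //; lia.
Qed.

(** The first entries are compared, say [k < k']. If the run of [k] is nonempty, the projection to
    {A+k-1, A+k} starts with different letters on the two sides. If it is empty, the letter [B.+1]
    occurs only on the side of [k']. *)
Lemma normal_form_inj B A ks ks' : B <= A -> size ks = size ks' ->
  ballot B A ks -> ballot B A ks' ->
  trace_eq (normal_form B A ks) (normal_form B A ks') -> ks = ks'.
Proof.
elim: ks ks' B A => [|k ks IH] [|k' ks'] // B A BA [sz] /=.
case/andP=> h1 b1 /andP[h2 b2] H.
suff Ek : k = k'.
  move: H b2; rewrite -Ek => /trace_eq_catI H b2.
  by rewrite (IH _ _ _ h1 sz b1 b2 H).
wlog lt : k k' ks ks' sz h1 b1 h2 b2 H {IH} / k < k'.
  move=> W; case: (ltngtP k k') => // [kk|kk]; first exact: (W k k' ks ks').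
  by apply/esym; apply: (W k' k ks' ks) => //; exact: trace_eq_sym.
have k'0 : 0 < k' by lia.
exfalso; move: H; rewrite k'0.
case: ifP => [k0|k0] [pe pr]; last first.
  have : B.+1 \in rev (iota B.+1 (A + k' - B.+1)) ++ normal_form B.+1 (A + k') ks'.
    by rewrite mem_cat mem_rev mem_iota; lia.
  by rewrite -(perm_mem pe) => /normal_form_gt; rewrite ltnn.
case: (ltnP B.+1 (A + k)) => BAk.
  have := pr (A + k).-1; rewrite !proj_cat !proj_run ifN; last by lia.
  rewrite ifT; last by lia.
  rewrite ifT /=; last by lia.
  by case; lia.
have : B.+1 \in rev (iota B.+1 (A + k' - B.+1)) ++ normal_form B.+1 (A + k') ks'.
  by rewrite mem_cat mem_rev mem_iota; lia.
rewrite -(perm_mem pe) mem_cat mem_rev mem_iota => /orP[|/normal_form_gt]; lia.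
Qed.

(* The elements below [c] in the heap of [rcons x c] form a chain
   [c < c + 1 < ... < c + m]. *)
Lemma extract_run c (x : seq nat) : c \notin x -> all (fun y => y.+1 != c) x ->
  alternating x -> exists m (u : seq nat),
  trace_eq (rcons x c) (rev (iota c m.+1) ++ u) /\ {subset u <= x}.
Proof.
move: {2}(size x) (leqnn (size x)) => l.
elim: l x c => [|l IH] x c xl cx px ax.
  by case: x xl {cx px ax} => // _; exists 0, [::]; split; first exact: trace_eq_refl.
have comm s : {subset s <= x} -> c.+1 \notin s -> all (commuting c) s.
  move=> sx cs; apply/allP => y ys; have yx := sx _ ys.
  rewrite /commuting /adjacent !negb_or (allP px _ yx) andbT.
  by apply/andP; split; [apply: contraNneq cx|apply: contraNneq cs] => ->.
case: (boolP (c.+1 \in x)) => c1x; last first.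
  exists 0, x; split=> //; apply: trace_eq_sym; exact: (trace_eq_move (comm x _ _)).
have [x1 [x2 [E c1x1]]] := split_first c1x.
have sub1 : {subset x1 <= x} by move=> y; rewrite E mem_cat => ->.
have sub2 : {subset x2 <= x} by move=> y; rewrite E mem_cat in_cons => ->; rewrite !orbT.
(* Since [c] is absent from [x], alternation on {c, c+1} allows a single [c.+1]. *)
have c1x2 : c.+1 \notin x2.
  have := ax c; rewrite E proj_cat /= eqxx orbT => /cat_sorted2[_].
  case Ex2 : (proj c x2) => [|y r] /=.
    move=> _; apply/negP => h; have : c.+1 \in proj c x2.
      by rewrite mem_filter eqxx orbT.
    by rewrite Ex2.
  have : y \in proj c x2 by rewrite Ex2 mem_head.
  rewrite mem_filter => /andP[/orP[]/eqP-> h]; last by rewrite eqxx.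
  by move: (sub2 _ h); rewrite (negPf cx).
have [] := IH x1 c.+1.
- by move: xl; rewrite E size_cat /=; lia.
- by [].
- apply/allP => y /sub1; rewrite eqSS; apply: contraTneq => -> //.
- by move: ax; rewrite E; exact: alternating_catl.
move=> m [u [H sub]]; exists m.+1, (u ++ x2); split; last first.
  by move=> y; rewrite mem_cat => /orP[/sub|]; [exact: sub1|exact: sub2].
apply: (@trace_eq_trans _ ((rcons x1 c.+1) ++ (c :: x2))).
  rewrite E rcons_cat rcons_cons -cat_rcons; apply: trace_eq_cat.
    exact: trace_eq_refl.
  by apply: trace_eq_sym; apply: trace_eq_move; exact: comm.
apply: (@trace_eq_trans _ ((rev (iota c.+1 m.+1) ++ u) ++ (c :: x2))).
  by apply: trace_eq_cat => //; exact: trace_eq_refl.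
rewrite [iota c m.+2]/= rev_cons -/(iota c.+1 m.+1) -cats1 -!catA.
apply: trace_eq_cat; first exact: trace_eq_refl.
rewrite -cat_rcons -[[:: c] ++ _]/((c :: u) ++ x2).
apply: trace_eq_cat; last exact: trace_eq_refl.
apply: trace_eq_sym; apply: trace_eq_move; apply: comm.
  by move=> y /sub /sub1.
by apply: contra c1x1; exact: sub.
Qed.

(** Induction on the number [N - B] of falls still to be placed: the letter [B.+1] either is absent,
    and the next fall carries no run, or ends a run that can be pulled to the front. *)
Lemma normal_form_surj N B A w : B <= A <= N -> normalizable N B A w ->
  exists ks, [/\ size ks = N - B, ballot B A ks & trace_eq w (normal_form B A ks)].
Proof.
move: {2}(N - B) (erefl (N - B)) => l.
elim: l B A w => [|l IH] B A w El /andP[BA AN] [letters alt hd].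
  exists [::]; split=> /=; rewrite ?El //; first by lia.
  case: w letters {alt hd} => [|x w] /=; first by move=> _; exact: trace_eq_refl.
  by lia.
case: (boolP (B.+1 \in w)) => Bw; last first.
  (* At height 0 a rise has to be inserted before the fall, giving a peak of height 1 with empty
     run; at positive height no rise is inserted. *)
  pose k := (A == B) : nat.
  have letters' : all (fun x => B.+1 < x < N) w.
    apply/allP => x xw; have := allP letters _ xw.
    have : x != B.+1 by apply: contraNneq Bw => <-.
    by lia.
  have [] := IH B.+1 (A + k) w _ _ _; [lia|rewrite /k; lia| |].
    by split=> // c cA; apply: hd; move: cA; rewrite /k; lia.
  move=> ks [sz bal tr]; exists (k :: ks); split=> /=.
  - by rewrite sz; lia.
  - by rewrite bal andbT /k; lia.
  - case: ifP => // k0.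
    by have -> : A + k - B.+1 = 0 by move: k0; rewrite /k; lia.
have [x [y [E Bx]]] := split_first Bw.
have sub1 z : z \in x -> z \in w by rewrite E mem_cat => ->.
have sub2 z : z \in y -> z \in w by rewrite E mem_cat in_cons => ->; rewrite !orbT.
have [] := @extract_run B.+1 x Bx.
- by apply/allP => z /sub1 /(allP letters); lia.
- by move: alt; rewrite E; exact: alternating_catl.
move=> m [u [H sub]].
have {}H : trace_eq w (rev (iota B.+1 m.+1) ++ (u ++ y)).
  rewrite E -cat_rcons catA; apply: trace_eq_cat => //; exact: trace_eq_refl.
have subw z : z \in u ++ y -> z \in w.
  by rewrite mem_cat => /orP[/sub/sub1|/sub2].
have alt' := trace_eq_alternating H alt.
have projw c : proj c w = (if B < c.+1 < B.+1 + m.+1 then [:: c.+1] else [::])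
    ++ (if B < c < B.+1 + m.+1 then [:: c] else [::]) ++ proj c (u ++ y).
  by rewrite (proj2 H) proj_cat proj_run -catA.
(* Otherwise the top letter of the run would be smaller than [A] and would come first in the
   projection with its successor, against [hd]. Hence the number of rises chosen below is
   positive. *)
have mA : A < B.+1 + m.+1.
  rewrite ltnNge; apply/negP => le.
  have := hd (B.+1 + m); rewrite projw ifN; last by lia.
  rewrite ifT /=; last by lia.
  by move=> /(_ _); lia.
have mN : B.+1 + m < N.
  have : B.+1 + m \in w by rewrite (perm_mem (proj1 H)) mem_cat mem_rev mem_iota; lia.
  by move/(allP letters); lia.
have Buy : B.+1 \notin u ++ y.
  have := alt B; rewrite projw ifT; last by lia.
  rewrite ifN ?ltnn //=; case Ep : (proj B (u ++ y)) => [|z r] /=.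
    move=> _; apply/negP => h; have : B.+1 \in proj B (u ++ y).
      by rewrite mem_filter eqxx orbT.
    by rewrite Ep.
  have : z \in proj B (u ++ y) by rewrite Ep mem_head.
  rewrite mem_filter => /andP[zB /subw /(allP letters)]; lia.
have [] := IH B.+1 (B.+1 + m.+1) (u ++ y); [lia|lia| |].
  split.
  - apply/allP => z zu; have := allP letters _ (subw _ zu).
    have : z != B.+1 by apply: contraNneq Buy => <-.
    by lia.
  - exact: alternating_catr alt'.
  (* The run has just contributed [c], so alternation makes c+1 the next letter of the projection,
     if there is one. *)
  - move=> c cB; have := alt c; rewrite projw [in X in _ ++ X]ifT; last by lia.
    move=> /cat_sorted2[_] /=.
    case Ep : (proj c (u ++ y)) => [//|z r] /= /andP[cz _].
    have : z \in proj c (u ++ y) by rewrite Ep mem_head.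
    by rewrite mem_filter => /andP[zc _]; lia.
move=> ks [sz bal tr]; exists (B.+1 + m.+1 - A :: ks).
have eA : A + (B.+1 + m.+1 - A) = B.+1 + m.+1 by lia.
split=> /=; rewrite ?eA ?sz; first lia.
  by rewrite bal andbT; lia.
rewrite ifT; last by lia.
have -> : B.+1 + m.+1 - B.+1 = m.+1 by lia.
apply: trace_eq_trans H _; apply: trace_eq_cat => //; exact: trace_eq_refl.
Qed.

End NormalForm.

(** * Dyck paths *)

Section DyckCode.
Implicit Types (p : seq bool) (ks : seq nat) (h k : nat).
Local Open Scope nat_scope.

Fixpoint rises k p : seq nat :=
  match p with
  | [::] => [::]
  | true :: p' => rises k.+1 p'
  | false :: p' => k :: rises 0 p'
  end.

Definition path_of_rises ks : seq bool :=
  flatten [seq rcons (nseq k true) false | k <- ks].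

Fixpoint dyck_from h p : bool :=
  match p with
  | [::] => h == 0
  | true :: p' => dyck_from h.+1 p'
  | false :: p' => (0 < h) && dyck_from h.-1 p'
  end.

Lemma path_height_cons b p i : path_height (b :: p) i.+1 =
  ((if b then 1 else -1) + path_height p i)%R.
Proof. by rewrite /path_height /= big_cons. Qed.

Lemma path_height0 p : path_height p 0 = 0%R.
Proof. by rewrite /path_height take0 big_nil. Qed.

Lemma dyck_fromP h p : reflect
  ((forall i, (i <= size p)%N -> 0 <= h%:Z + path_height p i)%R /\
   (h%:Z + path_height p (size p) = 0)%R) (dyck_from h p).
Proof.
elim: p h => [|b p IH] h /=.
  rewrite path_height0 addr0; apply: (iffP eqP) => [->|[_]]; last by case.
  by split=> // -[] // _; rewrite path_height0 addr0.
have E (h' : nat) : (h'%:Z = h%:Z + (if b then 1 else -1))%R -> forall i,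
   (h'%:Z + path_height p i = h%:Z + path_height (b :: p) i.+1)%R.
  by move=> e i; rewrite path_height_cons e addrA.
have {}IH (h' : nat) : (h'%:Z = h%:Z + (if b then 1 else -1))%R ->
  reflect ((forall i, (i <= (size p).+1)%N -> 0 <= h%:Z + path_height (b :: p) i)%R /\
   (h%:Z + path_height (b :: p) (size p).+1 = 0)%R) (dyck_from h' p).
  move=> e; apply: (iffP (IH h')) => -[h1 h2]; rewrite -?(E _ e) in h2 *.
    by split=> // -[|i] ip; rewrite ?path_height0 ?addr0 // -(E _ e); exact: h1.
  by split=> // i ip; rewrite (E _ e); exact: h1.
case: b E IH => E IH; first by apply: IH; lia.
case: h E IH => [|h] E IH /=; last by apply: IH; lia.
by constructor=> -[] /(_ 1 isT); rewrite path_height_cons path_height0.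
Qed.

Lemma is_dyckE p : is_dyck p = dyck_from 0 p.
Proof.
apply/andP/dyck_fromP => [[/forallP h /eqP e]|[h e]]; split.
- by move=> i ip; rewrite add0r; have := h (Ordinal (ip : i < (size p).+1)).
- by rewrite add0r.
- by apply/forallP => i; rewrite -[path_height _ _]add0r; apply: h; rewrite -ltnS.
- by rewrite -e add0r.
Qed.

Lemma path_of_rises_cons k ks :
  path_of_rises (k :: ks) = nseq k true ++ false :: path_of_rises ks.
Proof. by rewrite /path_of_rises /= cat_rcons. Qed.

(** [rises] drops the rises that no fall follows. The bound [k <= h] rules them out: at the end the
    height is 0, so no rise is pending. *)
Lemma dyck_from_rises h k p :
  dyck_from h p -> k <= h -> path_of_rises (rises k p) = nseq k true ++ p.
Proof.
elim: p h k => [|[] p IH] h k /=; first by move=> /eqP ->; case: k.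
  by move=> d kh; rewrite (IH _ _ d) //=; elim: k {kh} => //= k ->.
case/andP=> h0 d kh; by rewrite path_of_rises_cons (IH _ _ d).
Qed.

Lemma rises_path ks : rises 0 (path_of_rises ks) = ks.
Proof.
have rises_nseq j k p : rises j (nseq k true ++ false :: p) = j + k :: rises 0 p.
  by elim: k j => [|k IHk] j /=; [rewrite addn0|rewrite IHk addSnnS].
by elim: ks => // k ks IH; rewrite path_of_rises_cons rises_nseq IH.
Qed.

Lemma dyck_from_path h k ks :
  dyck_from h (path_of_rises (k :: ks)) =
  (0 < h + k) && dyck_from (h + k).-1 (path_of_rises ks).
Proof.
rewrite path_of_rises_cons.
elim: k h => [|k IH] h /=; first by rewrite addn0.
by rewrite IH addSnnS.
Qed.

Lemma ballot_dyck B A ks : B <= A ->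
  ballot B A ks = dyck_from (A - B) (path_of_rises ks).
Proof.
elim: ks B A => [|k ks IH] B A BA; first by rewrite /= subn_eq0; lia.
rewrite dyck_from_path /=; case: (ltnP B (A + k)) => BAk /=.
  have -> : 0 < A - B + k by lia.
  by rewrite IH //=; congr dyck_from; lia.
by have -> : 0 < A - B + k = false by lia.
Qed.

Lemma size_path_of_rises ks : size (path_of_rises ks) = size ks + sumn ks.
Proof.
elim: ks => //= k ks IH.
by rewrite path_of_rises_cons size_cat /= size_nseq IH; lia.
Qed.

Lemma ballot_sumn B A ks : ballot B A ks -> A + sumn ks = B + size ks.
Proof.
elim: ks B A => [|k ks IH] B A /=; first by move=> /eqP ->; rewrite !addn0.
by case/andP => _ /IH; lia.
Qed.

(** The -1 inside the sum absorbs the number of peaks, and the initial height [h] makes the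
    statistic computable fall by fall. *)
Definition stat_from (h : int) p : int :=
  (\sum_(i <- peaks p) (h + path_height p i.+1 - 1))%R.

Lemma peaks_cons b p : peaks (b :: p) =
  (if b && (ohead p == Some false) then [:: 0] else [::]) ++ map succn (peaks p).
Proof.
rewrite /peaks; case: p => [|c p] /=; first by rewrite andbF.
rewrite -[1]/(succn 0) -add1n iotaDl filter_map /=.
by case: b; case: c.
Qed.

Lemma stat_from_cons (h : int) b p : stat_from h (b :: p) =
  ((if b && (ohead p == Some false) then h else 0)
    + stat_from (h + (if b then 1 else -1)) p)%R.
Proof.
rewrite /stat_from peaks_cons big_cat big_map /=; congr (_ + _)%R; last first.
  by apply: eq_bigr => i _; rewrite path_height_cons addrA.
case: b => /=; last by rewrite big_nil.
case: ifP => _; last by rewrite big_nil.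
by rewrite big_seq1 path_height_cons path_height0 addr0 addrK.
Qed.

Lemma stat_from_path (h : int) k ks : stat_from h (path_of_rises (k :: ks)) =
  ((if (0 < k)%N then h + k%:Z - 1 else 0)
    + stat_from (h + k%:Z - 1) (path_of_rises ks))%R.
Proof.
rewrite path_of_rises_cons.
elim: k h => [|k IH] h /=; rewrite stat_from_cons /=; first by rewrite addr0.
rewrite IH; have -> : (h + 1 + k%:Z = h + k.+1%:Z)%R by lia.
case: k {IH} => [|k] /=; last by rewrite add0r.
by rewrite add0r; lia.
Qed.

Lemma size_normal_form B A ks : B <= A -> ballot B A ks ->
  stat_from (A%:Z - B%:Z)%R (path_of_rises ks) = Posz (size (normal_form B A ks)).
Proof.
elim: ks B A => [|k ks IH] B A BA /=.
  by move=> _; rewrite /stat_from big_nil.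
case/andP=> BAk bal; rewrite stat_from_path size_cat PoszD.
have -> : (A%:Z - B%:Z + k%:Z - 1 = (A + k)%:Z - B.+1%:Z)%R by lia.
rewrite (IH _ _ BAk bal); congr (_ + _)%R.
by case: ifP => k0 //; rewrite size_rev size_iota; lia.
Qed.

Definition dyck_rises m (D : dyck_path m) : seq nat := rises 0 (val (val D)).

Lemma dyck_risesK m (D : dyck_path m) :
  path_of_rises (dyck_rises D) = val (val D).
Proof.
by have := valP D; rewrite is_dyckE => d; exact: (dyck_from_rises d (leqnn 0)).
Qed.

Lemma dyck_rises_ballot m (D : dyck_path m) : ballot 0 0 (dyck_rises D).
Proof. by rewrite ballot_dyck // dyck_risesK -is_dyckE; exact: (valP D). Qed.

Lemma size_dyck_rises m (D : dyck_path m) : size (dyck_rises D) = m.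
Proof.
have := ballot_sumn (dyck_rises_ballot D).
have := size_path_of_rises (dyck_rises D).
by rewrite dyck_risesK size_tuple; lia.
Qed.

Lemma dyck_rises_inj m : injective (@dyck_rises m).
Proof.
by move=> D D' E; do 2 apply: val_inj; rewrite -!dyck_risesK E.
Qed.

Lemma dyck_rises_surj m ks : size ks = m -> ballot 0 0 ks ->
  exists D : dyck_path m, dyck_rises D = ks.
Proof.
move=> sz bal; have szp : size (path_of_rises ks) == m.*2.
  by have := ballot_sumn bal; rewrite size_path_of_rises; lia.
have dp : is_dyck (Tuple szp) by rewrite is_dyckE -(@ballot_dyck 0 0).
by exists (exist _ (Tuple szp) dp); exact: rises_path.
Qed.

Lemma peak_stat_dyck m (D : dyck_path m) :
  peak_stat D = Posz (size (normal_form 0 0 (dyck_rises D))).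
Proof.
rewrite -(size_normal_form _ (dyck_rises_ballot D)) // dyck_risesK /stat_from.
rewrite /peak_stat /sum_peak_heights sumrB; congr (_ - _)%R.
  by apply: eq_bigr => i _; rewrite subrr add0r.
by rewrite big_const_seq count_predT iter_addr_0 -mulr_natr mul1r natz.
Qed.

End DyckCode.

(** * Transport along the weight graph *)

Section Transport.
Context (V : Type) (E : seq nat -> V -> Prop) (psi : nat -> V -> V).
Implicit Types (a x y z k l j p : nat) (s t u w pre : seq nat) (v : V).

Hypothesis psi_weight : forall s x y t v, commuting x y ->
  E (s ++ x :: y :: t) v -> E (s ++ y :: x :: t) (psi (size s) v).
Hypothesis psi_invol : forall s x y t v, commuting x y ->
  E (s ++ x :: y :: t) v -> psi (size s) (psi (size s) v) = v.
Hypothesis psi_comm : forall k l v, k.+1 < l -> psi k (psi l v) = psi l (psi k v).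
Hypothesis psi_braid : forall s x y z t v,
  commuting x y -> commuting x z -> commuting y z -> E (s ++ x :: y :: z :: t) v ->
  psi (size s) (psi (size s).+1 (psi (size s) v)) =
  psi (size s).+1 (psi (size s) (psi (size s).+1 v)).

(** The operators of indices j, j+1, .., j+p-1 are applied in this order: the letter at position [j]
    moves [p] places to the right. *)
Fixpoint carry j p v := if p is p'.+1 then psi (j + p') (carry j p' v) else v.

Lemma carry_weight a pre s t v : all (commuting a) s ->
  E (pre ++ a :: s ++ t) v -> E (pre ++ s ++ a :: t) (carry (size pre) (size s) v).
Proof.
elim/last_ind: s t => [//|s b IH] t; rewrite all_rcons => /andP[ab cs].
rewrite !cat_rcons => /(IH _ cs); rewrite size_rcons catA => H.
by have := psi_weight ab H; rewrite size_cat -catA.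
Qed.

Lemma carry_comm k j p v : (k.+1 < j) || (j + p < k) ->
  psi k (carry j p v) = carry j p (psi k v).
Proof.
elim: p => //= p IH kj; rewrite -IH; last by lia.
case/orP: kj => kj; first by rewrite psi_comm //; lia.
by rewrite -psi_comm //; lia.
Qed.

Lemma carryD j p q v : carry j (p + q) v = carry (j + p) q (carry j p v).
Proof. by elim: q => [|q IH]; rewrite ?addn0 // addnS /= IH addnA. Qed.

Lemma rem_first a s t : a \notin s -> rem a (s ++ a :: t) = s ++ t.
Proof.
elim: s => [|b s IH] /=; first by rewrite eqxx.
by rewrite in_cons negb_or eq_sym => /andP[/negPf -> /IH ->].
Qed.

Lemma index_first a s t : a \notin s -> index a (s ++ a :: t) = size s.
Proof. by move=> as_; rewrite index_cat (negPf as_) /= eqxx addn0. Qed.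

(* Carrying the first letter [a] of [w] to its place in [u] and transporting the
   rest recursively gives the transport from [w] to [u]; that one more step
   [psi_k] turns it into the transport to the swapped word is the involution
   relation when [a] moves, the braid relation when [a] is carried across both
   swapped letters, and commutation otherwise. *)
Lemma transport w pre v : E (pre ++ w) v -> exists f : seq nat -> V,
  [/\ f w = v, forall u, trace_eq w u -> E (pre ++ u) (f u) &
      forall s x y t, commuting x y -> trace_eq w (s ++ x :: y :: t) ->
        psi (size pre + size s) (f (s ++ x :: y :: t)) = f (s ++ y :: x :: t)].
Proof.
elim: w pre v => [|a w IH] pre v Ev.
  exists (fun=> v); split=> // [u|s x y t _] [/perm_size]; first by case: u.
  by rewrite size_cat /=; lia.
have [|f [fw fE fpsi]] := IH (rcons pre a) v; first by rewrite cat_rcons.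
have {}fE u : trace_eq w u -> E (pre ++ a :: u) (f u).
  by move/fE; rewrite cat_rcons.
have {}fpsi s x y t : commuting x y -> trace_eq w (s ++ x :: y :: t) ->
    psi (size pre + size s).+1 (f (s ++ x :: y :: t)) = f (s ++ y :: x :: t).
  by move=> xy /(fpsi _ _ _ _ xy); rewrite size_rcons addSn.
pose g u := carry (size pre) (index a u) (f (rem a u)).
have gE s t : a \notin s -> g (s ++ a :: t) = carry (size pre) (size s) (f (s ++ t)).
  by move=> as_; rewrite /g index_first // rem_first.
exists g; split; first by rewrite /g /= eqxx fw.
  move=> u /trace_eq_cons_split[s [t [-> as_ cs /fE Ef]]].
  by rewrite gE //; exact: carry_weight.
move=> s x y t xy H; have nxy : x != y by case/andP: xy.
case: (boolP (a \in s)) => [/split_first[s1 [s2 [Es as1]]]|as_].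
  (* The letter [a] settles to the left of the swapped pair, so its journey commutes with the
     swap. *)
  rewrite {}Es -!catA /= in H *; have [cs {}H] := trace_eq_head H as1.
  rewrite !gE // carry_comm; last by rewrite size_cat /=; lia.
  by congr carry; move: H; rewrite !catA => /(fpsi _ _ _ _ xy) <-;
     congr psi; rewrite !size_cat /=; lia.
case: (eqVneq x a) => [xa|xa].
  subst x; have [cs H'] := trace_eq_head H as_.
  rewrite gE // -[s ++ [:: y, a & t]]cat_rcons gE; last first.
    by rewrite mem_rcons in_cons negb_or nxy.
  by rewrite size_rcons cat_rcons.
case: (eqVneq y a) => [ya|ya].
  subst y; rewrite -cat_rcons in H *.
  have asx : a \notin rcons s x by rewrite mem_rcons in_cons negb_or eq_sym xa.
  have [cs H'] := trace_eq_head H asx.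
  rewrite !gE // size_rcons /= cat_rcons.
  move: cs; rewrite all_rcons => /andP[_ cs].
  have := fE _ H'; rewrite cat_rcons => /(carry_weight cs); rewrite catA.
  move/psi_invol; rewrite size_cat; apply; by rewrite commutingC.
have at_ : a \in t.
  have : a \in s ++ x :: y :: t by rewrite -(perm_mem (proj1 H)) mem_head.
  by rewrite mem_cat !in_cons (negPf as_) !(eq_sym a) (negPf xa) (negPf ya).
have [t1 [t2 [Et at1]]] := split_first at_.
have spl c d : s ++ c :: d :: t = (s ++ c :: d :: t1) ++ a :: t2.
  by rewrite Et -catA.
have nin c d : c != a -> d != a -> a \notin s ++ c :: d :: t1.
  by move=> ca da; rewrite mem_cat !in_cons !negb_or as_ !(eq_sym a) ca da.
move: H; rewrite !spl => /trace_eq_head-/(_ (nin _ _ xa ya))[].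
rewrite all_cat /= => /and4P[cs ax ay _]; rewrite -catA /= => H.
rewrite !gE ?nin // !size_cat /= -!catA /=.
have Ex := carry_weight cs (fE _ H).
(* The journey of [a] is cut into the parts across [s], across the pair [x], [y], and across [t1].
   The outer parts commute with the swap; the middle part is the braid relation. *)
rewrite !addnS -!addSn -![(size s).+2 + _]/((size s).+2 + size t1) !carryD /=.
rewrite carry_comm; last by lia.
congr carry; rewrite !addnS -(fpsi _ _ _ _ xy H).
rewrite -[in RHS]carry_comm; last by lia.
have := @psi_braid (pre ++ s) a x y (t1 ++ t2)
  (carry (size pre) (size s) (f (s ++ x :: y :: t1 ++ t2))) ax ay xy.
by rewrite -catA size_cat; apply.
Qed.

End Transport.

(** * Homogeneous components *)

Lemma homogeneous_seqW (w : seq nat) :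
  (forall a s t r, a \notin t -> w = s ++ a :: t ++ a :: r ->
     1 < count (adjacent a) t) ->
  homogeneous_seq w.
Proof.
move=> h a s t r.
case: (boolP (a \in t)) => [/split_first[t1 [t2 [-> at1]]]|at_]; last exact: h.
by rewrite -catA => /(h _ _ _ _ at1); rewrite count_cat; lia.
Qed.

(** Every letter of [t] other than a neighbour of [a] commutes with [a] and can be moved out. The
    two remaining patterns, [a a] and [a b a], are those that the defining relations exclude from
    the weights of a representation in one degree. *)
Lemma trace_eq_squeeze a (s t r : seq nat) : a \notin t -> count (adjacent a) t <= 1 ->
  (exists s' r', trace_eq (s ++ a :: t ++ a :: r) (s' ++ a :: a :: r')) \/
  (exists s' b r', adjacent a b /\
     trace_eq (s ++ a :: t ++ a :: r) (s' ++ a :: b :: a :: r')).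
Proof.
move=> at_ ct.
have comm u : {subset u <= t} -> ~~ has (adjacent a) u -> all (commuting a) u.
  move=> ut /hasPn h; apply/allP => x xu; rewrite /commuting h // andbT.
  by apply: contraNneq at_ => ->; exact: ut.
case: (boolP (has (adjacent a) t)) => [ht|nt]; last first.
  left; exists (s ++ t), r; rewrite -catA -[t ++ a :: a :: r]cat_rcons -cat_cons.
  apply: trace_eq_cat (trace_eq_refl _) (trace_eq_cat _ (trace_eq_refl _)).
  by apply: trace_eq_move; exact: comm.
right; have [b [t1 [t2 [Et ab nt1 nt2]]]] : exists b t1 t2, [/\ t = t1 ++ b :: t2,
    adjacent a b, ~~ has (adjacent a) t1 & ~~ has (adjacent a) t2].
  elim: t ct ht {at_ comm} => //= b t IH; case: (boolP (adjacent a b)) => ab.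
    by move=> h _; exists b, [::], t; split; rewrite ?ab // has_count; lia.
  by move=> /IH {}IH /IH [c [t1 [t2 [-> ac h1 h2]]]]; exists c, (b :: t1), t2;
     split=> //=; rewrite (negPf ab).
have sub1 : {subset t1 <= t} by move=> x; rewrite Et mem_cat => ->.
have sub2 : {subset t2 <= t} by move=> x; rewrite Et mem_cat in_cons => ->; rewrite !orbT.
exists (s ++ t1), b, (t2 ++ r); split=> //; rewrite Et -!catA /=.
apply: trace_eq_cat (trace_eq_refl _) _.
have -> : a :: t1 ++ b :: t2 ++ a :: r = (a :: t1) ++ b :: (rcons t2 a ++ r).
  by rewrite cat_rcons.
have -> : t1 ++ a :: b :: a :: t2 ++ r = (rcons t1 a) ++ b :: ((a :: t2) ++ r).
  by rewrite cat_rcons.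
apply: trace_eq_cat; first by apply: trace_eq_move; exact: comm.
apply: (@trace_eq_cat [:: b] [:: b]); first exact: trace_eq_refl.
apply: trace_eq_cat (trace_eq_refl _); apply: trace_eq_sym.
by apply: trace_eq_move; exact: comm.
Qed.

Section WordSeq.
Context (n : nat) (Q : typeA_quiver n) (alpha : Qplus n).
Local Notation d := (ht alpha).
Local Notation word := (word alpha).
Implicit Types (w v : word) (k : 'I_d.-1).

(* The vertex [i : 'I_n] becomes the letter [i + 1], so that [0] is never used. *)
Definition word_seq w : seq nat := [seq (nat_of_ord i).+1 | i <- val (val w)].

Lemma word_seq_inj : injective word_seq.
Proof.
move=> w v /inj_map E; do 2 apply: val_inj; apply: E.
by move=> i j [/val_inj].
Qed.

Lemma size_word_seq w : size (word_seq w) = d.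
Proof. by rewrite size_map size_tuple. Qed.

Lemma word_seq_letters w : all (fun x => 0 < x < n.+1) (word_seq w).
Proof. by apply/allP => x /mapP[i _ ->]; rewrite /= ltnS ltn_ord. Qed.

Lemma word_seq_neq0 w : 0 \notin word_seq w.
Proof. by apply/negP => /(allP (word_seq_letters w)). Qed.

Lemma nth_word_seq w (i : 'I_d) : nth 0 (word_seq w) i = (letter w i).+1.
Proof.
rewrite (nth_map (letter w i)) ?size_tuple //.
by rewrite [in RHS]/letter (tnth_nth (letter w i)).
Qed.

Lemma neighborE (i j : 'I_n) : neighbor Q i j = adjacent i.+1 j.+1.
Proof. by rewrite /neighbor arrow_adjacent. Qed.

Lemma word_seq_split w k : exists s t, [/\ size s = k,
  word_seq w = s ++ (letter w (pos0 k)).+1 :: (letter w (pos1 k)).+1 :: t &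
  word_seq (swap k w) = s ++ (letter w (pos1 k)).+1 :: (letter w (pos0 k)).+1 :: t].
Proof.
have kd := pos1_subproof k.
have E v : word_seq v = take k (word_seq v) ++ (letter v (pos0 k)).+1 ::
    (letter v (pos1 k)).+1 :: drop k.+2 (word_seq v).
  rewrite -{1}(cat_take_drop k (word_seq v)); congr (_ ++ _).
  rewrite (drop_nth 0) ?size_word_seq 1?ltnW // (drop_nth 0) ?size_word_seq //.
  by rewrite -(nth_word_seq v (pos0 k)) -(nth_word_seq v (pos1 k)).
have nthS i : i < d -> i != k -> i != k.+1 ->
    nth 0 (word_seq (swap k w)) i = nth 0 (word_seq w) i.
  move=> id ik ik1; rewrite -[i]/(nat_of_ord (Ordinal id)) !nth_word_seq.
  by rewrite letter_swap tpermD // -val_eqE /= eq_sym.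
exists (take k (word_seq w)), (drop k.+2 (word_seq w)); split.
- by rewrite size_takel // size_word_seq; lia.
- exact: E.
rewrite E !letter_swap tpermL tpermR; congr (_ ++ _ :: _ :: _).
  apply: (@eq_from_nth _ 0); rewrite !size_takel ?size_word_seq //; try lia.
  by move=> i ik; rewrite !nth_take // nthS //; lia.
apply: (@eq_from_nth _ 0); rewrite !size_drop !size_word_seq // => i ik.
by rewrite !nth_drop nthS //; lia.
Qed.

Lemma word_seq_swap w s x y t : word_seq w = s ++ x :: y :: t ->
  exists k, [/\ k = size s :> nat, (letter w (pos0 k)).+1 = x,
    (letter w (pos1 k)).+1 = y & word_seq (swap k w) = s ++ y :: x :: t].
Proof.
move=> E; have sd : size s < d.-1.
  by rewrite -(size_word_seq w) E size_cat /=; lia.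
have [k kE] : exists k : 'I_d.-1, k = size s :> nat by exists (Ordinal sd).
have [s' [t' [sz E' Es]]] := word_seq_split w k.
move/eqP: E'; rewrite E eqseq_cat; last by rewrite sz kE.
by case/andP=> /eqP Ess /eqP[-> -> ->]; exists k; rewrite Es Ess sz.
Qed.

Lemma admissibleE k w : admissible Q k w =
  commuting (letter w (pos0 k)).+1 (letter w (pos1 k)).+1.
Proof. by rewrite /admissible neighborE /commuting eqSS. Qed.

Lemma weight_edge_trace w v : weight_edge Q w v -> trace_eq (word_seq w) (word_seq v).
Proof.
case/existsP=> k /and3P[/eqP -> h1 h2].
have [s [t [_ -> ->]]] := word_seq_split w k.
apply: trace_eq_cat (trace_eq_refl _) _.
apply: (@trace_eq_cat [:: _; _] [:: _; _]) (trace_eq_refl _).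
by apply: trace_eq_swap; rewrite -admissibleE /admissible h1.
Qed.

Lemma connect_trace w v :
  connect (@weight_edge n Q alpha) w v -> trace_eq (word_seq w) (word_seq v).
Proof.
case/connectP=> p; elim: p w => [|x p IH] w /=.
  by move=> _ ->; exact: trace_eq_refl.
by case/andP=> /weight_edge_trace e h1 h2; exact: trace_eq_trans e (IH _ h1 h2).
Qed.

(** Swaps of sequences lift to edges of the weight graph, so a sequence equivalent to that of a word
    again comes from a word of the same weight. *)
Lemma trace_connect w (u : seq nat) : trace_eq (word_seq w) u ->
  exists2 v, word_seq v = u & connect (@weight_edge n Q alpha) w v.
Proof.
pose P u := exists2 v, word_seq v = u & connect (@weight_edge n Q alpha) w v.
move=> H; apply: (@trace_eq_ind P _ _ _ H); last by exists w.
move=> s x y t xy [v Ev wv]; have [k [_ kx ky Ek]] := word_seq_swap Ev.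
exists (swap k v) => //; apply: connect_trans wv (connect1 _).
apply/existsP; exists k; rewrite eqxx /=.
by have := admissibleE k v; rewrite kx ky xy /admissible.
Qed.

Lemma connect_traceE w v :
  connect (@weight_edge n Q alpha) w v <-> trace_eq (word_seq w) (word_seq v).
Proof.
split; first exact: connect_trace.
by case/trace_connect=> u /word_seq_inj ->.
Qed.

Lemma homog_wordP w : homog_word Q w <-> homogeneous_seq (word_seq w).
Proof.
split=> [h a s t r E|h].
  have sz := congr1 size E; rewrite size_word_seq !size_cat /= size_cat /= in sz.
  have rd : size s < d by lia.
  have sd : (size s + (size t).+1) < d by lia.
  have nthr : nth 0 (word_seq w) (size s) = a by rewrite E nth_cat ltnn subnn.
  have nths : nth 0 (word_seq w) (size s + (size t).+1) = a.
    by rewrite E nth_cat ifN ?addKn //= ?nth_cat ?ltnn ?subnn //; lia.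
  move/forallP/(_ (Ordinal rd))/forallP/(_ (Ordinal sd)): h.
  have -> : letter w (Ordinal rd) = letter w (Ordinal sd).
    by apply: val_inj; apply: succn_inj; rewrite -!nth_word_seq /= nthr nths.
  rewrite eqxx andbT /= -{1}[size s]addn0 ltn_add2l /=.
  have inb (i : 'I_d) : size s < i -> i < size s + (size t).+1 ->
      neighbor Q (letter w (Ordinal sd)) (letter w i) ->
      i - (size s).+1 < size t /\ adjacent a (nth 0 t (i - (size s).+1)).
    move=> h1 h2; rewrite neighborE -!nth_word_seq /= nths.
    have -> : nth 0 (word_seq w) i = nth 0 t (i - (size s).+1).
      rewrite E nth_cat ifN; last by lia.
      have -> : i - size s = (i - (size s).+1).+1 by lia.
      by rewrite /= nth_cat ifT //; lia.
    by split=> //; lia.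
  case/existsP=> i /existsP[j /and5P[/= si ij js ni nj]].
  have [i1 i2] := inb i si (ltn_trans ij js) ni.
  have [j1 j2] := inb j (ltn_trans si ij) js nj.
  (* Cutting [t] just before the position of [j] leaves one neighbour in each half. *)
  rewrite -(cat_take_drop (j - (size s).+1) t) count_cat.
  have h1 : 0 < count (adjacent a) (take (j - (size s).+1) t).
    rewrite -has_count; apply/hasP; exists (nth 0 t (i - (size s).+1)) => //.
    have ij' : i - (size s).+1 < j - (size s).+1.
      exact: ltn_sub2r (leq_ltn_trans si ij) ij.
    by rewrite -(nth_take _ ij') mem_nth // size_takel // ltnW.
  have h2 : 0 < count (adjacent a) (drop (j - (size s).+1) t).
    rewrite -has_count; apply/hasP; exists (nth 0 t (j - (size s).+1)) => //.
    by rewrite -{1}[j - _]addn0 -nth_drop mem_nth // size_drop subn_gt0.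
  by lia.
apply/forallP => r; apply/forallP => s; apply/implyP => /andP[rs /eqP Ers].
pose W := word_seq w; pose t := drop r.+1 (take s W).
have sz : size W = d by exact: size_word_seq.
have szt : size t = s - r.+1.
  by rewrite size_drop size_takel // sz ltnW.
have EW : W = take r W ++ (letter w r).+1 :: t ++ (letter w r).+1 :: drop s.+1 W.
  rewrite {2}Ers -!nth_word_seq -/W -drop_nth ?sz //.
  have -> : take r W = take r (take s W) by rewrite take_takel // ltnW.
  have -> : nth 0 W r = nth 0 (take s W) r by rewrite nth_take.
  rewrite -cat_cons /t -drop_nth; last by rewrite size_takel // sz ltnW.
  by rewrite catA !cat_take_drop.
have cnt := h _ _ _ _ EW.
have [p [q [pq qt ap aq]]] : exists p q, [/\ p < q, q < size t,
    adjacent (letter w r).+1 (nth 0 t p) & adjacent (letter w r).+1 (nth 0 t q)].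
  move: cnt; move: (letter w r).+1 => a; elim: t {EW szt} => //= b t IH.
  case: (boolP (adjacent a b)) => ab cnt.
    have : has (adjacent a) t by rewrite has_count; lia.
    by move/(has_nthP 0) => [q qt aq]; exists 0, q.+1.
  by have [p [q [? ? ? ?]]] := IH cnt; exists p.+1, q.+1.
have nthE p' : p' < size t -> exists2 i : 'I_d, (nat_of_ord i = r.+1 + p')
    & nth 0 t p' = (letter w i).+1.
  move=> p't; have id : r.+1 + p' < d by have := ltn_ord s; lia.
  exists (Ordinal id) => //; rewrite -nth_word_seq /= nth_drop nth_take //; lia.
have [i Ei Ni] := nthE p (ltn_trans pq qt); have [j Ej Nj] := nthE q qt.
apply/existsP; exists i; apply/existsP; exists j.
by rewrite !neighborE -Ni -Nj ap aq Ei Ej; apply/and5P; split=> //; lia.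
Qed.

Lemma word_seq_homogeneous w :
  homog_word Q w <-> alternating (word_seq w).
Proof.
rewrite homog_wordP; split.
  exact: homogeneous_alternating (word_seq_neq0 w).
exact: alternating_homogeneous (word_seq_neq0 w).
Qed.

Definition component w : {set word} := [set v | connect (@weight_edge n Q alpha) w v].

Lemma mem_component w v : v \in component w <-> trace_eq (word_seq w) (word_seq v).
Proof. by rewrite inE; exact: connect_traceE. Qed.

Lemma component_homog_component w : alternating (word_seq w) ->
  homog_component Q (component w).
Proof.
move=> aw; apply/andP; split; first by apply/existsP; exists w.
apply/forall_inP => v /mem_component /trace_eq_alternating H.
by apply/word_seq_homogeneous; exact: H.
Qed.

Lemma homog_componentP (C : {set word}) : homog_component Q C ->
  exists2 w, alternating (word_seq w) & C = component w.
Proof.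
case/andP=> /existsP[w /eqP ->] /forall_inP h; exists w => //.
by apply/word_seq_homogeneous; apply: h; rewrite inE.
Qed.

Lemma component_eqP w v :
  component w = component v <-> trace_eq (word_seq w) (word_seq v).
Proof.
split=> [E|H]; first by apply/mem_component; rewrite E inE.
apply/setP => u; apply/idP/idP => /mem_component H'; apply/mem_component.
  exact: trace_eq_trans (trace_eq_sym H) H'.
exact: trace_eq_trans H H'.
Qed.

End WordSeq.

Local Open Scope ring_scope.

(** * Homogeneous representations *)

Lemma free_ind (R : nzRingType) (G : choiceType) (P : {malg R[{fmonom G}]} -> Prop) :
  P 1 -> P 0 -> (forall c a b, P a -> P b -> P (c *: a + b)) ->
  (forall a b, P a -> P b -> P (a * b)) -> (forall g, P << fmu g >>) -> forall a, P a.
Proof.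
move=> P1 P0 Plin Pmul Pg a.
have mon (m : {fmonom G}) : P << m >>.
  case: m => s; elim: s => [|g s IH].
    have -> : << FMonom [::] >> = 1 :> {malg R[{fmonom G}]} by rewrite -fmoneE.
    exact: P1.
  have -> : << FMonom (g :: s) >> = << fmu g >> * << FMonom s >> :> {malg R[{fmonom G}]}.
    rewrite malgM_def fgmulUU mulr1; congr << _ >>.
    by rewrite fmuE; apply/esym; exact: fmmulE.
  exact: Pmul.
rewrite [a]monalgE; elim: (finmap.enum_fset _) => [|m s IH]; first by rewrite big_nil.
rewrite big_cons; have -> : << a@_m *g m >> = a@_m *: << m >> :> {malg R[{fmonom G}]}.
  by apply/malgP => m'; rewrite mcoeffZ !mcoeffU mulrnAr mulr1.
exact: Plin.
Qed.

Section KLRInd.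
Context (F : fieldType) (n : nat) (Q : typeA_quiver n) (alpha : Qplus n).
Local Notation klr := (klr F Q alpha).
Local Notation free := {malg F[{fmonom klr_gen alpha}]}.
Local Notation rel :=
  (klr_rel Q (@free_e F n alpha) (@free_y F n alpha) (@free_psi F n alpha)).

Definition klr_pi (a : free) : klr := pres_pi rel a.

Lemma klr_piM a b : klr_pi (a * b) = klr_pi a * klr_pi b.
Proof. exact: pres_piMr. Qed.

Lemma klr_piD a b : klr_pi (a + b) = klr_pi a + klr_pi b.
Proof. exact: pres_piD. Qed.

Lemma klr_piB a b : klr_pi (a - b) = klr_pi a - klr_pi b.
Proof. by rewrite klr_piD; congr (_ + _); exact: pres_piN. Qed.

Lemma klr_pi0 : klr_pi 0 = 0.
Proof. exact: pres_pi0. Qed.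

Lemma klr_piZ c a : klr_pi (c *: a) = c *: klr_pi a.
Proof. by apply/esym; exact: pres_piZ. Qed.

Lemma klr_ind (P : klr -> Prop) :
  P 1 -> P 0 -> (forall c a b, P a -> P b -> P (c *: a + b)) ->
  (forall a b, P a -> P b -> P (a * b)) ->
  (forall w, P (klr_e F Q w)) -> (forall i, P (klr_y F Q i)) ->
  (forall k, P (klr_psi F Q k)) -> forall a, P a.
Proof.
move=> P1 P0 Plin Pmul Pe Py Ppsi x; rewrite -[x]pres_reprK.
move: (pres_repr x) => a; rewrite -[pres_pi _ _]/(klr_pi a).
elim/free_ind: a => [||c a b Pa Pb|a b Pa Pb|[[w|i]|k]].
- exact: P1.
- by rewrite klr_pi0.
- by rewrite klr_piD klr_piZ; exact: Plin.
- by rewrite klr_piM; exact: Pmul.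
- exact: Pe.
- exact: Py.
- exact: Ppsi.
Qed.

End KLRInd.

(** * Weights and transport when elements of nonzero degree act by zero *)

Section DegreeZeroAction.
Context (F : fieldType) (n : nat) (Q : typeA_quiver n) (alpha : Qplus n).
Local Notation d := (ht alpha).
Local Notation word := (word alpha).
(** [A] will be the free algebra, in which the relations hold only after applying [f]; this is the
    form of [f_rel]. The hypotheses [f_y] and [f_psi0] record concentration in one degree, because
    the elements they kill have nonzero degree. *)
Context (A : pzRingType) (e : word -> A) (y : 'I_d -> A) (psi : 'I_d.-1 -> A).
Context (V : vectType F) (f : A -> 'End(V)).
Implicit Types (w u : word) (k l : 'I_d.-1).

Hypothesis f0 : f 0 = 0.
Hypothesis fB : forall a b, f (a - b) = f a - f b.
Hypothesis fM : forall a b, f (a * b) = (f a \o f b)%VF.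
Hypothesis f_rel : forall a b, klr_rel Q e y psi a b -> f a = f b.
Hypothesis f_y : forall i, f (y i) = 0.
Hypothesis f_psi0 : forall k w, ~~ admissible Q k w -> f (psi k * e w) = 0.

Lemma fMv a b v : f (a * b) v = f a (f b v).
Proof. by rewrite fM comp_lfunE. Qed.

Lemma fBv a b v : f (a - b) v = f a v - f b v.
Proof. by rewrite fB add_lfunE opp_lfunE. Qed.

Lemma f_yv i v : f (y i) v = 0.
Proof. by rewrite f_y zero_lfunE. Qed.

Lemma f_relv a b v : klr_rel Q e y psi a b -> f a v = f b v.
Proof. by move/f_rel ->. Qed.

Lemma f_ee w u v : f (e w) (f (e u) v) = if w == u then f (e w) v else 0.
Proof.
rewrite -fMv (f_relv _ (KLR_ee _ _ _ _ w u)).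
by case: ifP => _ //; rewrite f0 zero_lfunE.
Qed.

Lemma f_psi_inadmissible k w v :
  f (e w) v = v -> ~~ admissible Q k w -> f (psi k) v = 0.
Proof. by move=> {1}<- adm; rewrite -fMv f_psi0 // zero_lfunE. Qed.

(** For equal letters the relation between [y] and [psi] writes e(w) as a combination of terms
    containing some [y], all of which act by 0. *)
Lemma weight_neq k w v : f (e w) v = v -> v != 0 ->
  letter w (pos0 k) != letter w (pos1 k).
Proof.
move=> wv; apply: contraNneq => E.
have := f_relv v (KLR_ypsi1 Q e y psi k w).
by rewrite E eqxx fMv wv fBv !fMv !f_yv linear0 subrr => <-.
Qed.

Lemma f_psi_invol k w v : f (e w) v = v -> admissible Q k w ->
  f (psi k) (f (psi k) v) = v.
Proof.
move=> wv /andP[/negPf h1]; rewrite negb_or => /andP[/negPf h2 /negPf h3].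
have := f_relv v (KLR_psi2 Q e y psi k w).
by rewrite /= h1 h2 h3 expr2 !fMv wv.
Qed.

Lemma f_psi_weight k w v : f (e w) v = v ->
  f (e (swap k w)) (f (psi k) v) = f (psi k) v.
Proof.
by move=> wv; rewrite -{2}wv -!fMv; apply/esym/f_relv; exact: KLR_psie.
Qed.

Lemma f_psi_comm k l v : (k.+1 < l)%N ->
  f (psi k) (f (psi l) v) = f (psi l) (f (psi k) v).
Proof. by move=> kl; rewrite -!fMv; apply: f_relv; apply: KLR_psi_comm; rewrite kl. Qed.

Lemma f_braid k l w v : l = k.+1 :> nat -> f (e w) v = v ->
  f (psi l) (f (psi k) (f (psi l) v)) - f (psi k) (f (psi l) (f (psi k) v)) =
  (let a := letter w (pos0 k) in let b := letter w (pos1 k) in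
   let c := letter w (pos1 l) in
   if (c == a) && arrow Q a b then v
   else if (c == a) && arrow Q b a then - v else 0).
Proof.
move=> kl wv; have := f_relv v (KLR_braid Q e y psi w kl).
rewrite /= fMv wv fBv !fMv => ->.
case: ifP => _ //; case: ifP => _; last by rewrite f0 zero_lfunE.
by rewrite -[- e w]sub0r fBv wv f0 zero_lfunE sub0r.
Qed.

(** On a pattern [a b a] with neighbours both [psi] kill [v], so the braid relation reads 0 = v or 0
    = -v. *)
Lemma weight_no_braid k l w v : l = k.+1 :> nat ->
  f (e w) v = v -> v != 0 -> letter w (pos1 l) = letter w (pos0 k) ->
  ~~ neighbor Q (letter w (pos0 k)) (letter w (pos1 k)).
Proof.
move=> kl wv v0 E; apply/negP => ab; case/eqP: v0.
have p : pos0 l = pos1 k by apply: val_inj; rewrite /= kl.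
have := f_braid kl wv; rewrite /= E eqxx /=.
rewrite (@f_psi_inadmissible l w v) //; last first.
  by rewrite /admissible p E neighborC ab andbF.
rewrite (@f_psi_inadmissible k w v) //; last by rewrite /admissible ab andbF.
rewrite !linear0 /= ?addr0 ?subrr; case/orP: ab => h; rewrite h //.
by case: ifP => _ // /eqP; rewrite eq_sym oppr_eq0 => /eqP.
Qed.

Definition occurs (s : seq nat) : Prop :=
  exists w v, [/\ word_seq w = s, f (e w) v = v & v != 0].

Lemma occurs_swap s a b t : commuting a b ->
  occurs (s ++ a :: b :: t) -> occurs (s ++ b :: a :: t).
Proof.
move=> ab [w [v [Ew wv v0]]]; have [k [_ ka kb Ek]] := word_seq_swap Ew.
have adm : admissible Q k w by rewrite admissibleE ka kb.
exists (swap k w), (f (psi k) v); split=> //; first exact: f_psi_weight.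
by apply: contraNneq v0 => E; rewrite -(f_psi_invol wv adm) E linear0.
Qed.

Lemma occurs_trace s t : trace_eq s t -> occurs s -> occurs t.
Proof. by apply: trace_eq_ind => *; exact: occurs_swap. Qed.

(** A failure of homogeneity is squeezed by commutations into [a a] or [a b a]; being a weight
    survives these moves since admissible [psi] are invertible. *)
Lemma occurs_homogeneous s : occurs s -> homogeneous_seq s.
Proof.
move=> os; apply: homogeneous_seqW => a x t r at_ E; rewrite ltnNge; apply/negP => ct.
have := trace_eq_squeeze x r at_ ct; rewrite -E => -[[s' [r' tr]]|[s' [b [r' [ab tr]]]]].
  have [w [v [Ew wv v0]]] := occurs_trace tr os.
  have [k [_ ka kb _]] := word_seq_swap Ew.
  have := weight_neq k wv v0; rewrite -val_eqE /=.
  by rewrite -eqSS ka kb eqxx.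
have [w [v [Ew wv v0]]] := occurs_trace tr os.
have [k [sk ka kb _]] := word_seq_swap Ew.
have Ew' : word_seq w = rcons s' a ++ b :: a :: r' by rewrite cat_rcons.
have [l [sl lb la _]] := word_seq_swap Ew'.
have := @weight_no_braid k l w v; rewrite sl sk size_rcons => /(_ erefl wv v0).
rewrite neighborE ka kb ab => H; apply: (elimT negP (H _)) => //.
by apply: val_inj; apply: succn_inj; rewrite la ka.
Qed.

(** The identity outside the range of positions keeps the commutation relation unconditional, as
    [transport] requires. *)
Definition psi_op (j : nat) (v : V) : V :=
  if insub j is Some k then f (psi k) v else v.

Lemma psi_opE (j : nat) k v : k = j :> nat -> psi_op j v = f (psi k) v.
Proof.
move=> kj; rewrite /psi_op insubT; first by rewrite -kj ltn_ord.
by move=> jd; congr (f (psi _) v); apply: val_inj.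
Qed.

Definition has_weight (s : seq nat) (v : V) : Prop :=
  exists2 w, word_seq w = s & f (e w) v = v.

Lemma psi_op_weight s a b t v : commuting a b ->
  has_weight (s ++ a :: b :: t) v -> has_weight (s ++ b :: a :: t) (psi_op (size s) v).
Proof.
move=> ab [w Ew wv]; have [k [sk ka kb Ek]] := word_seq_swap Ew.
by exists (swap k w) => //; rewrite (psi_opE _ sk); exact: f_psi_weight.
Qed.

Lemma psi_op_invol s a b t v : commuting a b ->
  has_weight (s ++ a :: b :: t) v -> psi_op (size s) (psi_op (size s) v) = v.
Proof.
move=> ab [w Ew wv]; have [k [sk ka kb Ek]] := word_seq_swap Ew.
by rewrite !(psi_opE _ sk); apply: (f_psi_invol wv); rewrite admissibleE ka kb.
Qed.

Lemma psi_op_comm (j i : nat) v : (j.+1 < i)%N ->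
  psi_op j (psi_op i v) = psi_op i (psi_op j v).
Proof.
move=> ji; rewrite /psi_op; case: (insubP 'I_d.-1 j) => [k _ kj|] //.
by case: (insubP 'I_d.-1 i) => [l _ li|] //; apply: f_psi_comm; rewrite kj li.
Qed.

Lemma psi_op_braid s a b c t v :
  commuting a b -> commuting a c -> commuting b c ->
  has_weight (s ++ a :: b :: c :: t) v ->
  psi_op (size s) (psi_op (size s).+1 (psi_op (size s) v)) =
  psi_op (size s).+1 (psi_op (size s) (psi_op (size s).+1 v)).
Proof.
move=> ab ac bc [w Ew wv]; have [k [sk ka kb _]] := word_seq_swap Ew.
have Ew' : word_seq w = rcons s a ++ b :: c :: t by rewrite cat_rcons.
have [l [sl lb lc _]] := word_seq_swap Ew'; rewrite size_rcons in sl.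
rewrite !(psi_opE _ sk) !(psi_opE _ sl); apply/esym/eqP; rewrite -subr_eq0.
rewrite (f_braid _ wv) ?sk //=; suff -> : letter w (pos1 l) == letter w (pos0 k) = false.
  by [].
apply/negP => /eqP E; move: ac; rewrite /commuting -ka -lc E eqxx //.
Qed.

(** The family is the transport of [v] over its component. It never vanishes because each admissible
    [psi] is an involution on the weight vectors concerned, so a zero would propagate back to
    [v]. *)
Lemma weight_family w v : f (e w) v = v -> v != 0 ->
  alternating (word_seq w) /\
  exists g : word -> V,
  [/\ forall u, u \in component Q w -> f (e u) (g u) = g u,
      forall u, u \in component Q w -> g u != 0 &
      forall k u, u \in component Q w ->
        f (psi k) (g u) = if admissible Q k u then g (swap k u) else 0].
Proof.
move=> wv v0; split.
  apply: homogeneous_alternating (word_seq_neq0 w) _.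
  by apply: occurs_homogeneous; exists w, v.
have [|g [gw gE gpsi]] := @transport V has_weight psi_op psi_op_weight psi_op_invol
  psi_op_comm psi_op_braid (word_seq w) [::] v; first by exists w.
have gW u : u \in component Q w -> f (e u) (g (word_seq u)) = g (word_seq u).
  by move=> /mem_component /gE[u' /word_seq_inj ->].
exists (g \o @word_seq n alpha); split=> //= [u /mem_component tr|k u uC].
  pose P s := trace_eq (word_seq w) s /\ g s != 0.
  suff [] : P (word_seq u) by [].
  apply: (@trace_eq_ind P _ _ _ tr); last first.
    by split; [exact: trace_eq_refl | rewrite gw].
  move=> s a b t ab [tr' gs]; split.
    apply: trace_eq_trans tr' _; apply: trace_eq_cat (trace_eq_refl _) _.
    exact: (@trace_eq_cat [:: a; b] [:: b; a] _ _ (trace_eq_swap ab) (trace_eq_refl _)).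
  apply: contraNneq gs => gs; rewrite -(gpsi _ _ _ _ ab tr') in gs.
  by rewrite -(psi_op_invol ab (gE _ tr')) gs /psi_op;
    case: insubP => [k _ _|_]; rewrite ?linear0.
case: ifP => adm; last by apply: (f_psi_inadmissible (gW _ uC)); rewrite adm.
have [s [t [ks Eu ->]]] := word_seq_split u k.
move: uC => /mem_component; rewrite Eu => tr.
rewrite admissibleE in adm; have := gpsi _ _ _ _ adm tr.
by rewrite (@psi_opE _ k).
Qed.

End DegreeZeroAction.

(** * Irreducibility of S(C) and classification of homogeneous representations *)

Section Classification.
Context (F : fieldType) (n : nat) (Q : typeA_quiver n) (alpha : Qplus n).
Local Notation d := (ht alpha).
Local Notation word := (word alpha).
Local Notation klr := (klr F Q alpha).
Local Notation e := (@klr_e F n Q alpha).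
Local Notation y := (@klr_y F n Q alpha).
Local Notation psi := (@klr_psi F n Q alpha).
Implicit Types (w u : word) (k : 'I_d.-1) (C : {set word}).

Lemma rep_intertwine (M N : graded_rep F Q alpha) (g : 'Hom(M, N)) :
  (forall w, (g \o rep_act M (e w) = rep_act N (e w) \o g)%VF) ->
  (forall i, (g \o rep_act M (y i) = rep_act N (y i) \o g)%VF) ->
  (forall k, (g \o rep_act M (psi k) = rep_act N (psi k) \o g)%VF) ->
  forall a v, g (rep_act M a v) = rep_act N a (g v).
Proof.
move=> he hy hpsi a.
have toF b : (g \o rep_act M b = rep_act N b \o g)%VF ->
    forall v, g (rep_act M b v) = rep_act N b (g v).
  by move=> E v; rewrite -!comp_lfunE E.
elim/klr_ind: a => [v|v|c a b ha hb v|a b ha hb v|w|i|k].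
- by rewrite !rep_act1 !id_lfunE.
- by rewrite !linear0 !zero_lfunE linear0.
- have -> : rep_act M (c *: a + b) = c *: rep_act M a + rep_act M b by exact: linearP.
  have -> : rep_act N (c *: a + b) = c *: rep_act N a + rep_act N b by exact: linearP.
  by rewrite !add_lfunE !scale_lfunE linearP /= ha hb.
- by rewrite !rep_actM !comp_lfunE ha hb.
- exact: toF.
- exact: toF.
- exact: toF.
Qed.

Lemma homog_component_connect C w u : homog_component Q C ->
  w \in C -> u \in C -> connect (@weight_edge n Q alpha) w u.
Proof.
case/homog_componentP=> w0 _ -> /mem_component h /mem_component h'.
by apply/connect_traceE; apply: trace_eq_trans h'; exact: trace_eq_sym.
Qed.

Section SRep.
Context (C : {set word}) (hC : homog_component Q C).
Local Notation S := (S_rep F hC).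

Lemma S_act_eE w (x : S_space F C) (wC : w \in C) :
  S_act C (e w) x = (x : {ffun _ -> F^o}) (exist _ w wC) *: S_vec F C w.
Proof.
rewrite {1}(S_decomp x) linear_sum /= (bigD1 (exist _ w wC)) //= linearZ /=.
rewrite (S_act_e F hC) eqxx big1 ?addr0 // => u uw; rewrite linearZ /= (S_act_e F hC).
case: eqP => [E|]; last by rewrite scaler0.
by case/eqP: uw; apply: val_inj.
Qed.

Lemma S_vec_neq0 w : w \in C -> S_vec F C w != 0.
Proof.
move=> wC; apply/eqP => /ffunP/(_ (exist _ w wC)); rewrite !ffunE eqxx.
by move/eqP; rewrite oner_eq0.
Qed.

(** An idempotent isolates a basis vector from a nonzero element of a stable subspace, and the [psi]
    carry it to all others along the connected set [C]. *)
Lemma S_rep_irreducible : irreducible_rep S.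
Proof.
have [w0 _ EC] := homog_componentP hC.
have w0C : w0 \in C by rewrite EC inE.
split.
  apply/eqP => E; have := memvf (S_vec F C w0 : S).
  by rewrite E memv0 (negPf (S_vec_neq0 w0C)).
move=> U stU; case: (eqVneq U 0%VS) => [->|U0]; [by left|right].
have stab (a : klr) x : x \in U -> S_act C a x \in U.
  by move=> xU; have := subvP (stU a) _ (memv_img _ xU).
have [x [xU x0]] : exists x, x \in U /\ x != 0.
  by exists (vpick U); rewrite memv_pick vpick0.
have [s xs] : exists s, (x : {ffun {w : word | w \in C} -> F^o}) s != 0.
  apply/existsP; apply: contraNT x0; rewrite negb_exists => /forallP h.
  by apply/eqP/ffunP => s; rewrite [RHS]ffunE; apply/eqP; move: (h s); rewrite negbK.
have sU : S_vec F C (val s) \in U.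
  have := stab (e (val s)) _ xU; rewrite (S_act_eE _ (valP s)).
  have -> : exist _ (val s) (valP s) = s by exact: val_inj.
  set c := fun_of_fin _ s => h; have c0 : c != 0 by [].
  by rewrite -[S_vec _ _ _]scale1r -(mulVf c0) -scalerA; apply: memvZ.
have adj : forall v, v \in C -> S_vec F C v \in U.
  move=> v vC; have := homog_component_connect hC (valP s) vC.
  case/connectP => p; elim: p (val s) (valP s) sU => [|z p IH] w wC wU /=.
    by move=> _ ->.
  case/andP=> wz zp Ev; have zC := component_edge hC wC wz.
  apply: (IH z zC) => //; move: wz zC => /existsP[k /andP[/eqP -> _]] sC.
  by have := stab (psi k) _ wU; rewrite (S_act_psi F hC k wC) sC.
apply/eqP; rewrite eqEsubv subvf /=.
apply/subvP => z _; rewrite (S_decomp z); apply: memv_suml => v _.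
by apply: memvZ; apply: adj; exact: (valP v).
Qed.

Lemma S_rep_conc : exists i, rep_comp S i = fullv.
Proof. by exists 0; rewrite /= /S_comp eqxx. Qed.

Definition S_homog_rep : homog_rep F Q alpha := HomogRep S_rep_irreducible S_rep_conc.

End SRep.
(** The component is recovered from the weights: for [w] in [C] but not in [C'], the idempotent e(w)
    fixes a nonzero vector on one side and acts by 0 on the other. *)
Lemma S_rep_sub C C' (hC : homog_component Q C) (hC' : homog_component Q C') :
  shift_iso (S_rep F hC) (S_rep F hC') -> C \subset C'.
Proof.
case=> g [/eqP g_inj _ gP _]; apply/subsetP => w wC; apply/negPn/negP => wC'.
have g0 : g (S_vec F C w : S_rep F hC) = 0.
  have := gP (e w) (S_vec F C w : S_rep F hC).
  rewrite [rep_act _ _ _](S_act_e F hC) eqxx => ->.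
  have -> : rep_act (S_rep F hC') (e w) = 0; last by rewrite zero_lfunE.
  apply: S_lfunP => v vC'; rewrite [LHS](S_act_e F hC') zero_lfunE.
  by case: eqP => // vw; move: wC'; rewrite -vw vC'.
have := S_vec_neq0 wC; rewrite -memv0.
by move: g0 => /eqP; rewrite -memv_ker (eqP g_inj) => ->.
Qed.

Lemma S_rep_inj C C' (hC : homog_component Q C) (hC' : homog_component Q C') :
  shift_iso (S_rep F hC) (S_rep F hC') -> C = C'.
Proof.
move=> h; apply/eqP; rewrite eqEsubset (S_rep_sub h).
exact: S_rep_sub (shift_iso_sym h).
Qed.

Section Concentrated.
Variable M : homog_rep F Q alpha.
Local Notation act := (rep_act M).

Lemma rep_comp_conc :
  exists i0, forall i, rep_comp M i = if i == i0 then fullv else 0%VS.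
Proof.
have [i0 h0] := homog_rep_conc M; exists i0 => i; case: eqVneq => [->//|ii0].
apply/eqP; rewrite -subv0; apply/subvP => v vi; rewrite memv0.
(* A nonzero [v] in another degree would yield the forbidden relation v + (-v) = 0 between
   components of distinct degrees. *)
pose u j := if j == i then v else if j == i0 then - v else 0.
apply/eqP; have := @rep_comp_indep _ _ _ _ M [:: i; i0] u.
rewrite /= in_cons in_nil orbF ii0 => /(_ isT) H.
have := H _ _ i; rewrite mem_head /u eqxx; apply=> //.
  move=> j; case: eqVneq => [-> //|_]; case: eqVneq => [->|_]; last exact: mem0v.
  by rewrite h0 memvf.
by rewrite big_cons big_seq1 eqxx eq_sym (negPf ii0) eqxx subrr.
Qed.

Lemma act_hom0 j a : klr_hom j a -> j != 0 -> act a = 0.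
Proof.
move=> /(@rep_act_deg _ _ _ _ M) h j0; have [i0 hc] := rep_comp_conc.
apply/lfunP => v; rewrite zero_lfunE.
have := h i0; rewrite !hc eqxx -subr_eq0 addrC addKr (negPf j0) => /subvP.
by move=> /(_ _ (memv_img _ (memvf v))); rewrite memv0 => /eqP.
Qed.

Definition free_op (a : klr_free F alpha) : 'End(M) := act (klr_pi Q a).

Lemma free_op0 : free_op 0 = 0.
Proof. by rewrite /free_op klr_pi0 linear0. Qed.

Lemma free_op1 : free_op 1 = \1%VF.
Proof. exact: rep_act1. Qed.

Lemma free_opD a b : free_op (a + b) = free_op a + free_op b.
Proof. by rewrite /free_op klr_piD linearD. Qed.

Lemma free_opB a b : free_op (a - b) = free_op a - free_op b.
Proof. by rewrite /free_op klr_piB linearB. Qed.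

Lemma free_opM a b : free_op (a * b) = (free_op a \o free_op b)%VF.
Proof. by rewrite /free_op klr_piM rep_actM. Qed.

Lemma free_op_rel a b :
  klr_rel Q (@free_e F n alpha) (@free_y F n alpha) (@free_psi F n alpha) a b ->
  free_op a = free_op b.
Proof.
by move=> h; congr (act _); apply/pres_piP; exact: RelIdeal_rel.
Qed.

Lemma free_op_y i : free_op (free_y F i) = 0.
Proof. exact: (act_hom0 (KLRhom_y _ _ i)). Qed.

Lemma free_op_psi0 k w : ~~ admissible Q k w ->
  free_op (free_psi F k * free_e F w) = 0.
Proof.
move=> adm; rewrite /free_op klr_piM; apply: (act_hom0 (KLRhom_psi _ _ k w)).
by move: adm; rewrite /admissible negb_and !negbK /psi_deg; case: ifP => //= _ ->.
Qed.

(** The idempotents sum to 1, so some weight component of any nonzero vector is nonzero. *)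
Lemma free_op_weight : exists w v, free_op (free_e F w) v = v /\ v != 0.
Proof.
have [full0 _] := homog_rep_irr M.
have v0 : vpick (fullv : {vspace M}) != 0 by rewrite vpick0.
set v := vpick _ in v0.
have sumv : v = \sum_w free_op (free_e F w) v.
  rewrite -sum_lfunE -(big_morph _ free_opD free_op0).
  by rewrite (free_op_rel (KLR_sum_e _ _ _ _)) free_op1 id_lfunE.
have [w wv] : exists w, free_op (free_e F w) v != 0.
  apply/existsP; apply: contraNT v0; rewrite negb_exists => /forallP h.
  by rewrite sumv big1 // => w _; apply/eqP; move: (h w); rewrite negbK.
exists w, (free_op (free_e F w) v); split=> //.
by rewrite (f_ee free_op0 free_opM free_op_rel) eqxx.
Qed.

Lemma homog_rep_classification : exists (C : {set word}) (hC : homog_component Q C),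
  shift_iso M (S_rep F hC).
Proof.
have [w [v [wv v0]]] := free_op_weight.
have [aw [g [gE g0 gpsi]]] := weight_family free_op0 free_opB free_opM free_op_rel
  free_op_y free_op_psi0 wv v0.
pose C := component Q w; have hC : homog_component Q C := component_homog_component Q aw.
exists C, hC; apply: shift_iso_sym.
(* The map sends the basis vector of each word to its transported vector. Its image and kernel are
   stable, so irreducibility of [M] makes it surjective and that of S(C) makes it injective. *)
pose G0 (x : S_space F C) : M := \sum_s (x : {ffun _ -> F^o}) s *: g (val s).
have G0lin : linear G0.
  move=> c x z; rewrite /G0 scaler_sumr -big_split /=.
  by apply: eq_bigr => s _; rewrite !ffunE scalerDl scalerA.
pose G0L := GRing.isLinear.Build F (S_space F C) M _ G0 G0lin.
pose G : 'Hom(S_rep F hC, M) := linfun (HB.pack G0 G0L : {linear S_space F C -> M}).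
have GE u : u \in C -> G (S_vec F C u) = g u.
  move=> uC; rewrite lfunE /= /G0 (bigD1 (exist _ u uC)) //= !ffunE eqxx scale1r.
  rewrite big1 ?addr0 // => s us; rewrite ffunE.
  case: eqP => [E|_]; last by rewrite scale0r.
  by case/eqP: us; apply: val_inj.
have homP (h1 h2 : 'Hom(S_rep F hC, M)) :
    (forall u, u \in C -> h1 (S_vec F C u) = h2 (S_vec F C u)) -> h1 = h2.
  move=> E; apply/lfunP => x; rewrite (S_decomp x) !linear_sum /=.
  by apply: eq_bigr => s _; rewrite !linearZ /= E //; exact: (valP s).
have GP := @rep_intertwine (S_rep F hC) M G.
have {}GP a x : G (rep_act (S_rep F hC) a x) = act a (G x).
  apply: GP => [u|i|k]; apply: homP => z zC; rewrite !comp_lfunE.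
  - rewrite [rep_act _ _ _](S_act_e F hC) (GE z zC) -(gE z zC).
    rewrite -[act (e u)]/(free_op (free_e F u)).
    rewrite (f_ee free_op0 free_opM free_op_rel) eq_sym; case: eqP => [->|_].
      by rewrite GE // gE.
    by rewrite linear0.
  - rewrite [rep_act _ _](S_act_y F hC) zero_lfunE linear0.
    by rewrite -[act (y i)]/(free_op (free_y F i)) free_op_y zero_lfunE.
  rewrite [rep_act _ _ _](S_act_psi F hC k zC) (GE z zC).
  rewrite -[act (psi k)]/(free_op (free_psi F k)) gpsi // (component_swap hC) //.
  case: ifP => adm; last by rewrite linear0.
  by rewrite GE // (component_swap hC).
have wC : w \in C by rewrite inE.
have Gw : G (S_vec F C w) != 0 by rewrite GE // g0.
have limgG : limg G = fullv.
  have [_ irr] := homog_rep_irr M.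
  have [a|E|//] := irr (limg G).
    apply/subvP => _ /memv_imgP[_ /memv_imgP[x _ ->] ->].
    by rewrite -GP memv_img // memvf.
  move: Gw; have := memv_img G (memvf (S_vec F C w : S_rep F hC)).
  by rewrite E memv0 => ->.
exists G; split=> //.
- have [_ irr] := S_rep_irreducible hC.
  have [a|//|E] := irr (lker G).
    apply/subvP => _ /memv_imgP[x xk ->].
    by rewrite memv_ker GP; move: xk; rewrite memv_ker => /eqP ->; rewrite linear0.
  move: Gw; have := memvf (S_vec F C w : S_rep F hC).
  by rewrite -E memv_ker => ->.
(* S(C) sits in degree 0 and [M] in degree [i0], which is therefore the shift. *)
have [i0 hc] := rep_comp_conc; exists i0 => i.
rewrite hc -subr_eq0 addrK /= /S_comp; case: ifP => _; last exact: limg0.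
exact: limgG.
Qed.

End Concentrated.

End Classification.

(** A class carries no chosen word, so the correspondence is handled as a relation and turned into a
    function by choice only at the end. *)
Lemma one_to_one_rel_bij (T1 T2 : Type) (R : T1 -> T2 -> Prop) :
  (forall x, exists y, R x y) -> (forall y, exists x, R x y) ->
  (forall x y y', R x y -> R x y' -> y = y') ->
  (forall x x' y, R x y -> R x' y -> x = x') ->
  exists f : T2 -> T1, bijective f /\ forall y, R (f y) y.
Proof.
move=> tot surj func inj.
pose f y := proj1_sig (cid (surj y)); pose g x := proj1_sig (cid (tot x)).
have fR y : R (f y) y := proj2_sig (cid (surj y)).
have gR x : R x (g x) := proj2_sig (cid (tot x)).
exists f; split=> //; exists g => [y|x].
  exact: func (gR _) (fR _).
exact: inj (fR _) (gR _).
Qed.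

(** * The correspondence between Dyck paths and classes of representations *)

Section WordOfSeq.
Context (n : nat).
Local Open Scope nat_scope.

Lemma count_word_seq (alpha : Qplus n) (w : word alpha) i :
  alpha i = count_mem (i : nat).+1 (word_seq w).
Proof.
have /forallP/(_ i)/eqP <- := valP w.
by rewrite count_map; apply: eq_count => j /=; rewrite eqSS.
Qed.

Lemma trace_eq_weight (alpha beta : Qplus n) (w : word alpha) (v : word beta) :
  trace_eq (word_seq w) (word_seq v) -> alpha = beta.
Proof.
move=> [/seq.permP E _]; apply/ffunP => i.
by rewrite (count_word_seq w) (count_word_seq v).
Qed.

Lemma word_of_seq (s : seq nat) : all (fun x => 0 < x < n.+1) s ->
  exists alpha (w : word (alpha : Qplus n)), word_seq w = s.
Proof.
move=> /allP hs; pose t : seq 'I_n := pmap insub (map predn s).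
have tE : map (fun i : 'I_n => (nat_of_ord i).+1) t = s.
  rewrite /t; elim: s hs {t} => //= x s IH hs.
  have := hs x (mem_head _ _); case: x hs => [|x] hs //= xn.
  rewrite insubT /= IH // => z zs; apply: hs; by rewrite in_cons zs orbT.
pose alpha : Qplus n := [ffun i => count_mem i t].
have szt : size t == ht alpha.
  apply/eqP; rewrite /ht; under eq_bigr do rewrite ffunE.
  elim: (t) => [|x r IH] /=; first by rewrite big1.
  rewrite big_split /= -IH (bigD1 x) //= eqxx big1 ?addn0 // => j.
  by rewrite eq_sym => /negPf ->.
have tw : [forall i, count_mem i (Tuple szt) == alpha i].
  by apply/forallP => i; rewrite ffunE.
by exists alpha, (exist _ (Tuple szt) tw).
Qed.

End WordOfSeq.

Section Correspondence.
Context (F : fieldType) (n : nat) (Q : typeA_quiver n).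

Definition corresponds (D : dyck_path n.+1) (c : rep_class F Q) : Prop :=
  exists alpha (w : word (alpha : Qplus n)) (hC : homog_component Q (component Q w)),
    word_seq w = normal_form 0 0 (dyck_rises D) /\
    c = class_of (S_homog_rep F hC).

Lemma class_of_weight alpha beta (M : homog_rep F Q alpha) (N : homog_rep F Q beta) :
  class_of M = class_of N -> alpha = beta.
Proof. by move=> /(congr1 (fun c : rep_class F Q => tag (proj1_sig c))). Qed.

Lemma corresponds_total D : exists c, corresponds D c.
Proof.
have [letters alt _] := normal_form_normalizable (leqnn 0) (dyck_rises_ballot D).
(* The path has [n.+1] falls, so the strict upper bound on letters is [n.+1] and they are exactly
   vertices. *)
rewrite add0n size_dyck_rises in letters.
have [alpha [w Ew]] := word_of_seq letters.
rewrite -Ew in alt; pose hC := component_homog_component Q alt.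
by exists (class_of (S_homog_rep F hC)), alpha, w, hC.
Qed.

Lemma corresponds_surj c : exists D, corresponds D c.
Proof.
case: c => c [alpha [M Ec]].
have -> : exist _ c (ex_intro _ alpha (ex_intro _ M Ec)) = class_of M.
  exact: eq_exist.
have [C [hC MC]] := homog_rep_classification M.
have [w alt EC] := homog_componentP hC; move: hC MC; rewrite {}EC => hC MC.
have [|ks [sz bal tr]] := @normal_form_surj n.+1 0 0 (word_seq w) isT.
  (* With [A = 0] no letter precedes, and the condition on heads is vacuous. *)
  by split=> [|//|c']; [exact: word_seq_letters|rewrite andbF].
rewrite subn0 in sz; have [D ED] := dyck_rises_surj sz bal.
exists D; rewrite /corresponds ED.
have [v Ev wv] := trace_connect Q tr.
have Cv : component Q w = component Q v.
  by apply/component_eqP; rewrite Ev.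
have hC' : homog_component Q (component Q v) by rewrite -Cv.
exists alpha, v, hC'; split=> //; apply/class_ofP.
apply: shift_iso_trans MC _; move: hC hC'; rewrite Cv => hC hC'.
rewrite /= (bool_irrelevance hC' hC); exact: shift_iso_refl.
Qed.

Lemma corresponds_func D c c' : corresponds D c -> corresponds D c' -> c = c'.
Proof.
case=> alpha [w [hC [Ew ->]]] [beta [v [hC' [Ev ->]]]].
have E : word_seq w = word_seq v by rewrite Ew Ev.
have ab : alpha = beta by apply: (@trace_eq_weight n alpha beta w v); rewrite E.
subst beta; have wv := word_seq_inj E; subst v.
by rewrite (bool_irrelevance hC hC').
Qed.

Lemma corresponds_inj D D' c : corresponds D c -> corresponds D' c -> D = D'.
Proof.
case=> alpha [w [hC [Ew ->]]] [beta [v [hC' [Ev Ec]]]].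
have ab := class_of_weight Ec; subst beta.
move/class_ofP/S_rep_inj/component_eqP: Ec; rewrite Ew Ev => tr.
apply: dyck_rises_inj; apply: normal_form_inj tr => //; try exact: dyck_rises_ballot.
by rewrite !size_dyck_rises.
Qed.

Lemma corresponds_peak_stat D alpha (M : homog_rep F Q alpha) k :
  corresponds D (class_of M) -> given_by_length M k -> peak_stat D = k%:Z.
Proof.
case=> beta [w [hC [Ew /class_of_weight ab]]] [C [hC' [_ szC]]]; subst beta.
have [v _ EC] := homog_componentP hC'.
(* A component is nonempty, so the length condition really forces [k] to be the height of
   [alpha]. *)
have vC : v \in C by rewrite EC inE.
by rewrite peak_stat_dyck -Ew size_word_seq -(szC _ vC) size_tuple.
Qed.

Lemma corresponds_given D c : corresponds D c ->
  exists k alpha (M : homog_rep F Q alpha),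
    [/\ peak_stat D = k%:Z, c = class_of M & given_by_length M k].
Proof.
case=> alpha [w [hC [Ew ->]]]; exists (ht alpha), alpha, (S_homog_rep F hC); split=> //.
  by rewrite peak_stat_dyck -Ew size_word_seq.
exists (component Q w), hC; split; first exact: shift_iso_refl.
by move=> v _; rewrite size_tuple.
Qed.

End Correspondence.

Theorem corollary2p2 (F : fieldType) (n : nat) (hn : (1 <= n)%N)
    (Q : typeA_quiver n) :
  (exists f : rep_class F Q -> dyck_path n.+1,
     bijective f /\
     forall (alpha : Qplus n) (M : homog_rep F Q alpha) (k : nat),
       given_by_length M k -> peak_stat (f (class_of M)) = k%:Z)
  /\
  (forall k : nat,
     exists g : rep_class_of_length F Q k -> 'I_(dyck_count n.+1 k),
       bijective g).
Proof.
split.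
  have [f [f_bij fR]] := one_to_one_rel_bij (@corresponds_total F n Q)
    (@corresponds_surj F n Q) (@corresponds_func F n Q) (@corresponds_inj F n Q).
  exists f; split=> // alpha M k.
  exact: corresponds_peak_stat (fR _).
move=> k; pose A := [set D : dyck_path n.+1 | peak_stat D == k%:Z].
(* The same correspondence is restricted to the paths with statistic [k], listed by [enum_val];
   preservation of the statistic keeps it total on both sides. *)
pose R (i : 'I_#|A|) (c : rep_class_of_length F Q k) :=
  corresponds (enum_val i) (proj1_sig c).
have [||||g [g_bij _]] := @one_to_one_rel_bij _ _ R; last by exists g.
- move=> i; have [c Dc] := corresponds_total F Q (enum_val i).
  have [k' [alpha [M [Ek Ec Mk]]]] := corresponds_given Dc.
  have kk : k' = k.
    by move: (enum_valP i); rewrite inE Ek => /eqP[].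
  rewrite kk in Mk; have h : exists alpha (M : homog_rep F Q alpha),
    c = class_of M /\ given_by_length M k by exists alpha, M.
  by exists (exist _ c h).
- move=> [c h]; have [D Dc] := corresponds_surj c.
  have DA : D \in A.
    case: h => alpha [M [Ec Mk]]; rewrite Ec in Dc.
    by rewrite inE (corresponds_peak_stat Dc Mk).
  by exists (enum_rank_in DA D); rewrite /R enum_rankK_in.
- by move=> i [c h] [c' h'] /corresponds_func cc /cc {}cc; apply: eq_exist.
by move=> i j c Ri Rj; apply: enum_val_inj; exact: corresponds_inj Ri Rj.
Qed.
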